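(* Let $S$ be a Damek--Ricci space, let $k$ be a non-negative integer and let $\alpha\in[1,2)$. There exists a constant $\gamma_{k,\alpha}>0$ such that, if $(1+r)/t\ge\gamma_{k,\alpha}$, then $$\Big|\frac{\partial^k}{\partial r^k}h_t(r)\Big|\gtrsim\Psi_k(r,t)\,h_t(r)$$ when either $r>1$ or $r^\alpha\big(1+\tfrac{1+r}{t}\big)<1$ (here $r,t>0$).
   Context: Damek--Ricci space. Let $\nu\ge1$ and $\mu\ge0$ be integers and let $z\mapsto J_z$ be a linear map from $\mathbb{R}^\nu$ to skew-symmetric $\mu\times\mu$ real matrices such that $J_z$ is orthogonal whenever $|z|=1$ (so $\mu$ is even; the degenerate case $\mu=0$, where the variable $x$ is absent, is allowed). Let $(e_\ell)$, $(u_k)$ be the standard bases of $\mathbb{R}^\mu$, $\mathbb{R}^\nu$. $S=\mathbb{R}^\mu\times\mathbb{R}^\nu\times\mathbb{R}^+$ is the group with law $(x,z,a)(x',z',a')=\big(x+\sqrt a\,x',\,z+az'+\tfrac12\sqrt a\sum_{k=1}^\nu(J_{u_k}x,x')u_k,\,aa'\big)$ and identity $e=(0,0,1)$. Set $Q=(\mu+2\nu)/2$ and $n=\mu+\nu+1=\dim S$. Left-invariant vector fields: $\mathbb{X}_0=a\partial_a$, $\mathbb{X}_\ell=\sqrt a\big(\partial_{x_\ell}+\tfrac12\sum_{k=1}^\nu(J_{u_k}x,e_\ell)\partial_{z_k}\big)$ for $1\le\ell\le\mu$, $\mathbb{X}_{\mu+k}=a\,\partial_{z_k}$ for $1\le k\le\nu$.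 $S$ carries the left-invariant Riemannian metric for which $\mathbb{X}_0,\dots,\mathbb{X}_{n-1}$ are orthonormal; $d$ is the Riemannian distance and $r(\underline{x})=d(\underline{x},e)$. The left Haar measure is $d\lambda=a^{-Q-1}\,dx\,dz\,da$. Heat kernel. $\mathcal{L}=-\sum_{j=0}^{n-1}\mathbb{X}_j^2+Q\mathbb{X}_0$ is the (non-negative) Laplace--Beltrami operator, essentially self-adjoint on $L^2(\lambda)$; $h_t$ is the right-convolution kernel of $e^{-t\mathcal{L}}$ (i.e. $e^{-t\mathcal{L}}f=f*h_t$, $f*g(\underline{x})=\int_S f(y)g(y^{-1}\underline{x})\,d\lambda(y)$). It is radial and is viewed as a function $h_t(r)$ on $[0,\infty)$. Let $\mathfrak{c}_0=2^{-\mu-\frac\nu2-1}\pi^{-\frac n2}$. Explicitly, $h_t(r)=\mathfrak{c}_0t^{-1/2}e^{-Q^2t/4}\big(-\tfrac1{\sinh r}\partial_r\big)^{\nu/2}\big(-\tfrac1{\sinh(r/2)}\partial_r\big)^{\mu/2}e^{-r^2/(4t)}$ if $\nu$ is even, and $h_t(r)=\mathfrak{c}_0\pi^{-1/2}t^{-1/2}e^{-Q^2t/4}\int_r^\infty\frac{\sinh s}{\sqrt{\cosh s-\cosh r}}\big(-\tfrac1{\sinh s}\partial_s\big)^{(\nu+1)/2}\big(-\tfrac1{\sinh(s/2)}\partial_s\big)^{\mu/2}e^{-s^2/(4t)}\,ds$ if $\nu$ is odd. For $t,r>0$: $\Psi_k(r,t)=\big(1+\tfrac1{\sqrt t}+\tfrac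 rt\big)^k$ if $r>1$, or if $r\le1$ and $k$ is even; $\Psi_k(r,t)=r\big(1+\tfrac1{\sqrt t}+\tfrac rt\big)^{k-1}\big(1+\tfrac1t\big)$ if $r\le1$ and $k$ is odd. $v\gtrsim w$ means $v\ge c\,w$ for some constant $c>0$ depending only on $S$, $k$ and $\alpha$ (not on $r,t$). *)

(* Defs.v *)
From mathcomp Require Import all_boot all_order all_algebra.
From mathcomp Require Import all_classical all_reals all_analysis.

Set Implicit Arguments.
Unset Strict Implicit.
Unset Printing Implicit Defensive.

Import Order.TTheory GRing.Theory Num.Theory.
Import numFieldNormedType.Exports.

Local Open Scope classical_set_scope.
Local Open Scope ring_scope.

(* MathComp-Analysis equips matrices with the sup norm, hence this definition. *)
Definition enorm (R : realType) (m : nat) (z : 'cV[R]_m) : R :=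
  Num.sqrt (\sum_(i < m) z i ord0 ^+ 2).

(* The data (nu, mu, J) determine the Damek-Ricci space: it is
   R^mu x R^nu x R^+ with the group law and left-invariant metric built from J. *)
Record damek_ricci (R : realType) := DamekRicci {
  nu : nat;
  mu : nat;
  J : {linear 'cV[R]_nu -> 'M[R]_mu};
  nu_ge1 : (1 <= nu)%N;
  J_skew : forall z : 'cV[R]_nu, (J z)^T = - J z;
  J_orthogonal : forall z : 'cV[R]_nu, enorm z = 1 -> (J z)^T *m J z = 1%:M
}.

Section HyperbolicFunctions.
Variable R : realType.

Definition sinh (x : R) : R := (expR x - expR (- x)) / 2.
Definition cosh (x : R) : R := (expR x + expR (- x)) / 2.

(* - (sinh r)^-1 d/dr and - (sinh (r/2))^-1 d/dr; meaningful for r != 0 *)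
Definition Dsinh (f : R -> R) : R -> R := fun r => - (derive1 f r / sinh r).
Definition Dsinh_half (f : R -> R) : R -> R :=
  fun r => - (derive1 f r / sinh (r / 2)).

End HyperbolicFunctions.

Section HeatKernel.
Variables (R : realType) (S : damek_ricci R).

Definition dimS : nat := (mu S + nu S + 1)%N.
Definition homdim : R := ((mu S)%:R + 2 * (nu S)%:R) / 2.

Definition c0 : R :=
  2 `^ (- (mu S)%:R - (nu S)%:R / 2 - 1) * pi `^ (- (dimS%:R / 2)).

Definition gauss (t : R) : R -> R := fun s => expR (- (s ^+ 2 / (4 * t))).

(* mu is even because J_z is skew-symmetric and orthogonal for unit z, so the
   exponent mu./2 is exact; so are (nu S)./2 and (nu S).+1./2 below. *)
Definition heat_base (t : R) : R -> R :=
  iter (mu S)./2 (@Dsinh_half R) (gauss t).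

Definition heat_even (t r : R) : R :=
  c0 * (Num.sqrt t)^-1 * expR (- (homdim ^+ 2 * t / 4)) *
  iter (nu S)./2 (@Dsinh R) (heat_base t) r.

Definition heat_odd (t r : R) : R :=
  c0 * (Num.sqrt pi)^-1 * (Num.sqrt t)^-1 * expR (- (homdim ^+ 2 * t / 4)) *
  \int[lebesgue_measure]_(s in `]r, +oo[)
     (sinh s / Num.sqrt (cosh s - cosh r) *
      iter (nu S).+1./2 (@Dsinh R) (heat_base t) s).

(* The heat kernel of the Laplace-Beltrami operator of S, as a function of the
   distance r to the identity, in the explicit form of
   Anker, Damek and Yacoub; meaningful for t, r > 0. *)
Definition heat_kernel (t r : R) : R :=
  if odd (nu S) then heat_odd t r else heat_even t r.

End HeatKernel.

Definition Psi (R : realType) (k : nat) (r t : R) : R :=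
  if (r <= 1) && odd k then
    r * (1 + (Num.sqrt t)^-1 + r / t) ^+ k.-1 * (1 + t^-1)
  else (1 + (Num.sqrt t)^-1 + r / t) ^+ k.

(* Main.v *)
Require Import Defs.
From mathcomp Require Import all_boot all_order all_algebra.
From mathcomp Require Import all_classical all_reals all_analysis.
From mathcomp Require Import measurable_realfun.
From mathcomp Require Import ring lra zify.
Set Implicit Arguments.
Unset Strict Implicit.
Unset Printing Implicit Defensive.
Import Order.TTheory GRing.Theory Num.Theory.
Import numFieldNormedType.Exports.
Local Open Scope classical_set_scope.
Local Open Scope ring_scope.

(** Up to a positive factor depending on t only, the kernel is obtained from the
Gaussian exp (- s^2 / 4t) by iterating D = - (sinh s)^-1 d/ds and its half-angle
analogue, followed, when nu is odd, by a half-integral in the variable cosh s.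
Put f_i = D^i h, so that f_i' = - sinh * f_(i+1); a sequence of functions with
this property is called a chain below. Repeated differentiation writes the k-th
derivative of h = f_0 as a sum of terms (-1)^i sinh^a cosh^b f_i with a + b = i
(derive1n_chain), and the theorem follows once it is known that
f_(i+1) / f_i is comparable with rate = r / (t sinh r), uniformly where
(1 + r) / t is bounded below.

Given that comparison, for r > 1 each step from i to i + 1 multiplies
sinh^i f_i by at least a constant times r / t, which is as large as desired, so
the term sinh^k f_k wins (derive1n_chain_large). For r <= 1 the ratio is of size
1 / t with t small, while a term with index i carries at least the power
r^(2i - k); hence the index i = ceil (k / 2) wins provided r^2 / t is small
(derive1n_chain_small). The hypothesis r^alpha (1 + (1 + r) / t) < 1 with
alpha < 2 is what makes r^2 / t small (parabolic_small). In both cases all the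
terms with the winning index have the same sign.

The comparison for the Gaussian family rests on positivity. In the variable
w = cosh (s / 2), the function (s / 2) / sinh (s / 2) is completely monotone, and
each - d/dw costs at most a factor C / w (sinhquoS_le). The same then holds for
the cone generated by its derivatives, 1 / w and the nonnegative constants
(cone_derive). Every function of the family is an element of this cone times the
Gaussian; applying D, the Gaussian contributes exactly rate / 2, and the
remainder is nonnegative and at most C / w^2 (Dsinh_cone), which is itself
dominated by the rate (invr_cosh2_le).

For odd nu the substitution cosh s = cosh r + v^2 turns the half-integral into
the integral of 2 F (s) over v > 0, with constant weight and fixed domain
(abel_substitution); hence the transform maps chains to chains
(is_derive_abel). Upper bounds survive integration because the rate is
decreasing in s, and lower bounds because a fixed fraction of the integral is
carried by r <= s <= r + 1, where the rate is comparable with its value at r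
(abel_concentration). *)

(** * Hyperbolic functions *)

Section hyperbolic.
Context {R : realType}.
Implicit Types s x y : R.

Lemma sinh0 : sinh (0 : R) = 0.
Proof. by rewrite /sinh oppr0 subrr mul0r. Qed.

Global Instance is_derive_sinh s : is_derive s 1 (@sinh R) (cosh s).
Proof.
by apply: is_derive_eq; rewrite /GRing.scale /= /cosh; field.
Qed.

Global Instance is_derive_cosh s : is_derive s 1 (@cosh R) (sinh s).
Proof.
by apply: is_derive_eq; rewrite /GRing.scale /= /sinh; field.
Qed.

Lemma cosh2_sinh2 s : cosh s ^+ 2 = 1 + sinh s ^+ 2.
Proof.
have := expRxMexpNx_1 s; rewrite /cosh /sinh => h.
set a := expR s in h *; set b := expR (- s) in h *.
have -> : ((a + b) / 2) ^+ 2 = ((a - b) / 2) ^+ 2 + a * b by field.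
by rewrite h addrC.
Qed.

Lemma cosh_sinh_expR s : cosh s + sinh s = expR s.
Proof. by rewrite /cosh /sinh; field. Qed.

Lemma coshB_sinh_expR s : cosh s - sinh s = expR (- s).
Proof. by rewrite /cosh /sinh; field. Qed.

Lemma sinhD x y : sinh (x + y) = sinh x * cosh y + cosh x * sinh y.
Proof. by rewrite /sinh /cosh opprD !expRD; field. Qed.

Lemma coshD x y : cosh (x + y) = cosh x * cosh y + sinh x * sinh y.
Proof. by rewrite /sinh /cosh opprD !expRD; field. Qed.

Lemma sinh_double s : sinh s = 2 * sinh (s / 2) * cosh (s / 2).
Proof. by rewrite {1}(_ : s = s / 2 + s / 2) ?sinhD; field. Qed.

Lemma cosh_gt0 s : 0 < cosh s.
Proof. by rewrite /cosh divr_gt0// addr_gt0 ?expR_gt0. Qed.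

Lemma sinh_gt0 s : 0 < s -> 0 < sinh s.
Proof. by move=> s0; rewrite /sinh divr_gt0// subr_gt0 ltr_expR; lra. Qed.

Lemma sinh_le x y : x <= y -> sinh x <= sinh y.
Proof. by move=> xy; rewrite /sinh ler_wpM2r// lerB// ler_expR ?lerN2. Qed.

Lemma cosh_ge1 s : 1 <= cosh s.
Proof.
have := cosh2_sinh2 s; have := cosh_gt0 s; have := sqr_ge0 (sinh s); nra.
Qed.

Lemma sinh_lt_cosh s : sinh s < cosh s.
Proof. rewrite /sinh /cosh; have := expR_gt0 (- s); lra. Qed.

Lemma cosh_gt1 s : 0 < s -> 1 < cosh s.
Proof.
move=> /sinh_gt0 h; have := cosh2_sinh2 s; have := cosh_gt0 s; nra.
Qed.

Lemma ge0_of_derive (f df : R -> R) :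
  (forall x, is_derive x 1 f (df x)) -> (forall x, 0 < x -> 0 <= df x) ->
  0 <= f 0 -> forall s, 0 <= s -> 0 <= f s.
Proof.
move=> fd df0 f0 s; rewrite le_eqVlt => /predU1P[<-//|s0].
have cf : {within `[0, s], continuous f}.
  by apply: derivable_within_continuous => x _; exact: (@ex_derive _ _ _ _ _ _ _ (fd x)).
have [c] := @MVT R f df 0 s s0 (fun x _ => fd x) cf.
rewrite in_itv/= subr0 => /andP[c0 cs] e.
have : 0 <= f s - f 0 by rewrite e mulr_ge0 ?df0// ltW.
by lra.
Qed.

Lemma ler_sinh s : 0 <= s -> s <= sinh s.
Proof.
move=> s0; rewrite -subr_ge0.
apply: (@ge0_of_derive (@sinh R - id) (fun x => cosh x - 1)) s0 => //.
- by move=> x _; rewrite subr_ge0 cosh_ge1.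
- by rewrite !fctE sinh0 subr0.
Qed.

Lemma ler_cosh (x y : R) : 0 <= x -> x <= y -> cosh x <= cosh y.
Proof.
move=> x0 xy; rewrite -(subrK x y) addrC coshD.
have sge0 (z : R) : 0 <= z -> 0 <= sinh z by move=> z0; apply: le_trans (ler_sinh z0).
have d0 : 0 <= y - x by rewrite subr_ge0.
have := mulr_ge0 (sge0 _ x0) (sge0 _ d0).
have := cosh_ge1 (y - x); have := cosh_gt0 x; nra.
Qed.

Lemma ltr_cosh r s : 0 <= r -> r < s -> cosh r < cosh s.
Proof.
move=> r0 rs; rewrite -(subrK r s) addrC coshD.
have c1 : 1 < cosh (s - r) by rewrite cosh_gt1// subr_gt0.
have s0 : 0 <= sinh r by apply: le_trans r0 (ler_sinh r0).
have s1 : 0 < sinh (s - r) by rewrite sinh_gt0// subr_gt0.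
have := mulr_ge0 s0 (ltW s1).
have : 0 < cosh r * (cosh (s - r) - 1) by rewrite mulr_gt0 ?cosh_gt0// subr_gt0.
by lra.
Qed.

End hyperbolic.

(** * Complete monotonicity of s / sinh s as a function of cosh s *)

Section sinh_quotient.
Context {R : realType}.
Implicit Types s x y : R.

(** Numerators of the iterates of - d/d(cosh s) on s / sinh s: the i-th iterate is
[sinhquo_num i s / sinh s ^+ (2 * i + 1)]. The recurrence is the differential
equation of arccosh w / sqrt (w^2 - 1). Working with the numerators, which are
entire and vanish at 0, avoids the removable singularity at s = 0. *)
Fixpoint sinhquo_num (i : nat) (s : R) : R :=
  match i with
  | 0 => s
  | 1 => s * cosh s - sinh s
  | (i''.+1 as i').+1 =>
      (2 * i' + 1)%:R * cosh s * sinhquo_num i' s - i'%:R ^+ 2 * sinh s ^+ 2 * sinhquo_num i'' s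
  end.

Lemma sinhquo_numSS i s : sinhquo_num i.+2 s =
  (2 * i.+1 + 1)%:R * cosh s * sinhquo_num i.+1 s - i.+1%:R ^+ 2 * sinh s ^+ 2 * sinhquo_num i s.
Proof. by []. Qed.

(** The numerators are successive integrals of one another, up to the positive
weight [sinh]; their positivity comes from here. *)
Lemma is_derive_sinhquo_num i s :
  is_derive s 1 (sinhquo_num i.+1) (i.+1%:R ^+ 2 * sinh s * sinhquo_num i s).
Proof.
suff : (forall s, is_derive s 1 (sinhquo_num i.+1) (i.+1%:R ^+ 2 * sinh s * sinhquo_num i s)) /\
    (forall s, is_derive s 1 (sinhquo_num i.+2) (i.+2%:R ^+ 2 * sinh s * sinhquo_num i.+1 s)).
  by case=> /(_ s).
have d1 x : is_derive x 1 (sinhquo_num 1) (1%:R ^+ 2 * sinh x * sinhquo_num 0 x).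
  apply: (@is_derive_eq _ _ _ (fun s => s * cosh s - sinh s)).
  rewrite /GRing.scale /=; ring.
elim: i {s} => [|i [IH1 IH2]].
  split=> // s.
  rewrite (_ : sinhquo_num 2 = fun x => 3%:R * cosh x * sinhquo_num 1 x - 1%:R ^+ 2 * sinh x ^+ 2 * x)//.
  apply: is_derive_eq; rewrite /GRing.scale /=; ring.
split=> // s.
rewrite (_ : sinhquo_num i.+3 = fun x => (2 * i.+2 + 1)%:R * cosh x * sinhquo_num i.+2 x
   - i.+2%:R ^+ 2 * sinh x ^+ 2 * sinhquo_num i.+1 x)//.
apply: is_derive_eq; rewrite sinhquo_numSS /GRing.scale /=; ring.
Qed.

Lemma sinhquo_num_at0 i : sinhquo_num i 0 = 0.
Proof.
suff : sinhquo_num i 0 = 0 /\ sinhquo_num i.+1 0 = 0 by case.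
elim: i => [|i [IH1 IH2]]; first by rewrite /= sinh0 mul0r subr0.
by split=> //; rewrite sinhquo_numSS IH1 IH2 !mulr0 subr0.
Qed.

Lemma sinhquo_num_ge0 i s : 0 <= s -> 0 <= sinhquo_num i s.
Proof.
elim: i s => // i IH s.
apply: (ge0_of_derive (is_derive_sinhquo_num i)); last by rewrite sinhquo_num_at0.
move=> x x0; apply: mulr_ge0; last exact/IH/ltW.
by apply: mulr_ge0; [exact: sqr_ge0|exact/ltW/sinh_gt0].
Qed.

Global Instance is_derive_coshV s :
  is_derive s 1 (fun x => (cosh x)^-1) (- (sinh s / cosh s ^+ 2)).
Proof.
have h : cosh s != 0 by rewrite gt_eqF ?cosh_gt0.
by apply: (is_derive_eq (is_deriveV h (is_derive_cosh s))); rewrite /GRing.scale /= mulNr mulrC.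
Qed.

(** Both sides vanish at 0, so it suffices to compare derivatives; the derivative
of the difference is nonnegative by the same inequality one index lower. Note
that [cosh s - (cosh s)^-1] is [sinh s ^+ 2 / cosh s]. *)
Lemma sinhquo_numS_le i s : 0 <= s ->
  sinhquo_num i.+1 s <= i.+1%:R * (cosh s - (cosh s)^-1) * sinhquo_num i s.
Proof.
elim: i s => [|i IH] s s0; rewrite -subr_ge0.
  move: s s0; apply: (@ge0_of_derive R (fun x => 1%:R * (cosh x - (cosh x)^-1) * x - sinhquo_num 1 x)
    (fun x => (sinh x / cosh x ^+ 2) * x + (cosh x - (cosh x)^-1))).
  - move=> x; have := is_derive_sinhquo_num 0 x => ?.
    apply: is_derive_eq; rewrite /GRing.scale /=; ring.
  - move=> x x0; have c1 := cosh_ge1 x; have h : (cosh x)^-1 <= 1 by rewrite invf_le1 ?cosh_gt0.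
    rewrite addr_ge0//; last by lra.
    have sx := ltW (sinh_gt0 x0); have x1 := ltW x0.
    by apply: mulr_ge0 => //; apply: divr_ge0 => //; exact: sqr_ge0.
  - by rewrite sinhquo_num_at0 mulr0 subr0.
move: s s0; apply: (@ge0_of_derive R
  (fun x => i.+2%:R * (cosh x - (cosh x)^-1) * sinhquo_num i.+1 x - sinhquo_num i.+2 x)
    (fun x => i.+2%:R * (sinh x / cosh x ^+ 2 * sinhquo_num i.+1 x +
       i.+1%:R * sinh x * (i.+1%:R * (cosh x - (cosh x)^-1) * sinhquo_num i x - sinhquo_num i.+1 x)))).
- move=> x; have := is_derive_sinhquo_num i.+1 x => ?; have := is_derive_sinhquo_num i x => ?.
  apply: is_derive_eq; rewrite /GRing.scale /=; ring.
- move=> x x0; have sx := ltW (sinh_gt0 x0); have x1 := ltW x0.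
  apply: mulr_ge0 => //; apply: addr_ge0; apply: mulr_ge0.
  + by apply: divr_ge0 => //; exact: sqr_ge0.
  + exact: sinhquo_num_ge0.
  + exact: mulr_ge0.
  + by rewrite subr_ge0 IH.
- by rewrite !sinhquo_num_at0 mulr0 subr0.
Qed.

Definition sinhquo (i : nat) (s : R) : R := sinhquo_num i s / sinh s ^+ (2 * i + 1).

Lemma sinhquo0 s : sinhquo 0 s = s / sinh s. Proof. by []. Qed.

Lemma sinhquo_ge0 i s : 0 < s -> 0 <= sinhquo i s.
Proof.
by move=> s0; rewrite divr_ge0 ?sinhquo_num_ge0 ?exprn_ge0// ltW// sinh_gt0.
Qed.

Lemma is_derive_sinhX n s :
  is_derive s 1 (fun x => sinh x ^+ n.+1) (n.+1%:R * sinh s ^+ n * cosh s).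
Proof. by have := is_deriveX n.+1 (is_derive_sinh s); rewrite exprfctE. Qed.

Lemma is_derive_sinhquo i s : 0 < s ->
  is_derive s 1 (sinhquo i) (- (sinh s * sinhquo i.+1 s)).
Proof.
move=> s0; have h : sinh s != 0 by rewrite gt_eqF ?sinh_gt0.
have hn n : sinh s ^+ n != 0 by rewrite expf_neq0.
have du : is_derive s 1 (sinhquo_num i) (((2 * i + 1)%:R * cosh s * sinhquo_num i s - sinhquo_num i.+1 s) / sinh s).
  case: i => [|i].
    by apply: is_derive_eq => /=; field.
  apply: (is_derive_eq (is_derive_sinhquo_num i s)); rewrite sinhquo_numSS; field.
  by [].
rewrite /sinhquo addn1.
have dv := @is_deriveV R (fun x => sinh x ^+ (2 * i).+1) _ _ _ (hn _) (is_derive_sinhX (2 * i) s).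
have -> : (2 * i.+1 + 1 = 2 * i + 3)%N by rewrite mulnS [(2 + _)%N]addnC -addnA.
apply: (is_derive_eq (is_deriveM du dv)).
rewrite /GRing.scale [sinh s ^+ (2 * i).+1]exprS (exprD _ (2 * i) 3) -[(2 * i).+1]addn1.
move: (sinhquo_num i.+1 s) (sinh s ^+ (2 * i)) (hn (2 * i)%N) => G p hp /=.
field.
by rewrite hp h.
Qed.

(** One derivative in w = cosh s costs a factor of order 1 / w, as for powers of
w. *)
Lemma sinhquoS_le i s : 0 < s -> sinhquo i.+1 s <= i.+1%:R * sinhquo i s / cosh s.
Proof.
move=> s0; have h := sinh_gt0 s0; have c := cosh_gt0 s.
have hn n : 0 < sinh s ^+ n by rewrite exprn_gt0.
rewrite /sinhquo ler_pdivrMr//.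
apply: le_trans (sinhquo_numS_le i (ltW s0)) _.
have -> : (2 * i.+1 + 1 = (2 * i + 1) + 2)%N by rewrite mulnS [(2 + _)%N]addnC addnAC.
rewrite le_eqVlt; apply/orP; left; apply/eqP.
have e : sinh s ^+ 2 = cosh s ^+ 2 - 1 by rewrite cosh2_sinh2; ring.
rewrite (exprD _ (2 * i + 1) 2) e; have := gt_eqF (hn (2 * i + 1)%N).
set p := sinh s ^+ _ => hp; field.
by rewrite hp gt_eqF.
Qed.

End sinh_quotient.

(** * Derivatives of functions known on the half-line *)

Section positive_derive.
Context {R : realType}.

Lemma is_derive_eq_gt0 (f g : R -> R) (s d : R) : 0 < s ->
  (forall x, 0 < x -> f x = g x) -> is_derive s 1 g d -> is_derive s 1 f d.
Proof.
move=> s0 fg; apply: near_eq_is_derive; near=> x; rewrite fg//.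
near: x; exact: lt_nbhsr.
Unshelve. all: end_near. Qed.

Lemma derive1_is_derive (f : R -> R) (s d : R) : is_derive s 1 f d -> derive1 f s = d.
Proof. by move=> h; rewrite derive1E derive_val. Qed.

Lemma is_derive_continuous (f : R -> R) (x d : R) :
  is_derive x 1 f d -> {for x, continuous f}.
Proof.
move=> h; apply: differentiable_continuous; apply/derivable1_diffP.
exact: (@ex_derive _ _ _ _ _ _ _ h).
Qed.

End positive_derive.

(** * A differentially closed cone and the Gaussian family *)

Section cone.
Context {R : realType}.

(** Functions of (t, s) that occur as coefficients of the Gaussian. Constants may
depend on t because the powers of 1 / t do; bounds must nevertheless be uniform
in t, which is why the cone contains families and not single functions. *)
Inductive cone : (R -> R -> R) -> Prop :=
| cone_cst (c : R -> R) : (forall t, 0 < t -> 0 <= c t) -> cone (fun t _ => c t)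
| cone_coshV : cone (fun _ s => (cosh (s / 2))^-1)
| cone_sinhquo i : cone (fun _ s => sinhquo i (s / 2))
| cone_add a b : cone a -> cone b -> cone (fun t s => a t s + b t s)
| cone_mul a b : cone a -> cone b -> cone (fun t s => a t s * b t s).

Lemma cone_ge0 a (t s : R) : cone a -> 0 < t -> 0 < s -> 0 <= a t s.
Proof.
move=> + t0 s0; elim=> [c|||a1 a2 _ h1 _ h2|a1 a2 _ h1 _ h2].
- exact.
- by rewrite invr_ge0 ltW// cosh_gt0.
- by move=> i; rewrite sinhquo_ge0// divr_gt0.
- exact: addr_ge0.
- exact: mulr_ge0.
Qed.

Global Instance is_derive_half (s : R) : is_derive s 1 (fun x : R => x / 2) (2^-1).
Proof. by apply: is_derive_eq; rewrite /GRing.scale /=; field. Qed.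

(** With w = cosh (s / 2), [da] is - da/dw: the cone is stable under this
operation, which costs at most C / w with C independent of t, since both
properties hold for generators and are inherited by sums and products. *)
Lemma cone_derive a : cone a ->
  exists2 da, cone da & exists2 C : R, 0 <= C & forall t s : R, 0 < t -> 0 < s ->
    is_derive s 1 (a t) (- (sinh (s / 2) / 2 * da t s)) /\
    da t s <= C * a t s / cosh (s / 2).
Proof.
elim=> {a} [c c0||i|a b ca [da cda [C C0 hC]] cb [db cdb [D D0 hD]]
                   |a b ca [da cda [C C0 hC]] cb [db cdb [D D0 hD]]].
- exists (fun _ _ => 0); first exact: (@cone_cst (fun=> 0)).
  exists 0 => // t s t0 s0; split; last by rewrite mul0r mul0r.
  by apply: is_derive_eq; rewrite mulr0 oppr0.
- exists (fun _ s => (cosh (s / 2))^-1 * (cosh (s / 2))^-1).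
    by apply: cone_mul; exact: cone_coshV.
  exists 1 => // t s t0 s0; split; last by rewrite mul1r.
  have /is_derive_eq := is_derive1_comp (g := fun x => x / 2) (is_derive_coshV (s / 2)) (is_derive_half s); apply.
  by field; rewrite gt_eqF ?cosh_gt0.
- exists (fun _ s => sinhquo i.+1 (s / 2)); first exact: cone_sinhquo.
  exists i.+1%:R => // t s t0 s0; have h : 0 < s / 2 by rewrite divr_gt0.
  split; last exact: sinhquoS_le.
  have /is_derive_eq := is_derive1_comp (g := fun x => x / 2) (is_derive_sinhquo i h) (is_derive_half s); apply.
  by field.
- exists (fun t s => da t s + db t s); first exact: cone_add.
  exists (C + D) => [|t s t0 s0]; first exact: addr_ge0.
  have [d1 l1] := hC t s t0 s0; have [d2 l2] := hD t s t0 s0.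
  split; first by apply: is_derive_eq; ring.
  apply: le_trans (lerD l1 l2) _; rewrite -mulrDl ler_wpM2r ?invr_ge0 ?(ltW (cosh_gt0 _))//.
  have := mulr_ge0 C0 (cone_ge0 cb t0 s0).
  have := mulr_ge0 D0 (cone_ge0 ca t0 s0).
  by lra.
- exists (fun t s => da t s * b t s + a t s * db t s).
    by apply: cone_add; exact: cone_mul.
  exists (C + D) => [|t s t0 s0]; first exact: addr_ge0.
  have [d1 l1] := hC t s t0 s0; have [d2 l2] := hD t s t0 s0.
  split; first by apply: is_derive_eq; rewrite /GRing.scale /=; ring.
  have a0 := cone_ge0 ca t0 s0; have b0 := cone_ge0 cb t0 s0.
  apply: le_trans (lerD (ler_wpM2r b0 l1) (ler_wpM2l a0 l2)) _.
  by rewrite le_eqVlt; apply/orP; left; apply/eqP; field; rewrite gt_eqF ?cosh_gt0.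
Qed.

Lemma is_derive_gauss (t s : R) : 0 < t ->
  is_derive s 1 (gauss t) (- (s / (2 * t)) * gauss t s).
Proof.
move=> t0; rewrite /gauss.
apply: is_derive_eq; rewrite /GRing.scale /=; field; rewrite gt_eqF//.
Qed.

(** The equality is asserted for s > 0 only: the operators divide by [sinh s]. *)
Definition cone_gauss (F : R -> R -> R) (a : R -> R -> R) :=
  forall t s : R, 0 < t -> 0 < s -> F t s = a t s * gauss t s.

Lemma is_derive_cone_gauss F a da (t s : R) : cone_gauss F a ->
  0 < t -> 0 < s ->
  is_derive s 1 (a t) (- (sinh (s / 2) / 2 * da t s)) ->
  is_derive s 1 (F t) (- (sinh (s / 2) / 2 *
    ((da t s + 2 / t * sinhquo 0 (s / 2) * a t s) * gauss t s))).
Proof.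
move=> Fa t0 s0 d.
apply: (@is_derive_eq_gt0 _ _ (fun x => a t x * gauss t x)) => //.
  by move=> x x0; exact: Fa.
have d2 := is_derive_gauss s t0.
apply: is_derive_eq; rewrite sinhquo0 /GRing.scale /=.
have h : sinh (s / 2) != 0 by rewrite gt_eqF// sinh_gt0// divr_gt0.
by field; rewrite h gt_eqF.
Qed.

Lemma Dsinh_half_cone F a : cone a -> cone_gauss F a ->
  exists2 b, cone b & cone_gauss (fun t => Dsinh_half (F t)) b.
Proof.
move=> ca Fa; have [da cda [C C0 hC]] := cone_derive ca.
exists (fun t s => 2^-1 * (da t s + 2 / t * sinhquo 0 (s / 2) * a t s)).
  apply: cone_mul; first by apply: (@cone_cst (fun=> 2^-1)) => t t0; rewrite invr_ge0.
  apply: cone_add => //; apply: cone_mul => //; apply: cone_mul; last exact: cone_sinhquo.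
  by apply: (@cone_cst (fun t => 2 / t)) => t t0; rewrite divr_ge0// ltW.
move=> t s t0 s0; have [d _] := hC t s t0 s0.
rewrite /Dsinh_half (derive1_is_derive (is_derive_cone_gauss Fa t0 s0 d)).
have h : sinh (s / 2) != 0 by rewrite gt_eqF// sinh_gt0// divr_gt0.
by field; rewrite h gt_eqF.
Qed.

(** Differentiating the Gaussian produces the main term s / (2 t sinh s), exactly;
differentiating the coefficient produces a nonnegative error, at most
C / cosh^2 (s / 2). *)
Lemma Dsinh_cone F a : cone a -> cone_gauss F a ->
  exists2 b, cone b & exists2 C : R, 0 <= C & cone_gauss (fun t => Dsinh (F t)) b /\
  forall t s : R, 0 < t -> 0 < s ->
   [/\ is_derive s 1 (F t) (- (sinh s * Dsinh (F t) s)),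
       s / (2 * t * sinh s) * F t s <= Dsinh (F t) s &
       Dsinh (F t) s <= (s / (2 * t * sinh s) + C / cosh (s / 2) ^+ 2) * F t s].
Proof.
move=> ca Fa; have [da cda [C C0 hC]] := cone_derive ca.
pose b t s := 4^-1 * ((cosh (s / 2))^-1 * (da t s + 2 / t * sinhquo 0 (s / 2) * a t s)).
have eb : cone_gauss (fun t => Dsinh (F t)) b.
  move=> t s t0 s0; have [d _] := hC t s t0 s0.
  rewrite /Dsinh (derive1_is_derive (is_derive_cone_gauss Fa t0 s0 d)).
  have h : sinh (s / 2) != 0 by rewrite gt_eqF// sinh_gt0// divr_gt0.
  have k := gt_eqF (cosh_gt0 (s / 2)).
  by rewrite (sinh_double s) /b; field; rewrite h k gt_eqF.
exists b.
  apply: cone_mul; first by apply: (@cone_cst (fun=> 4^-1)) => t t0; rewrite invr_ge0.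
  apply: cone_mul; first exact: cone_coshV.
  apply: cone_add => //; apply: cone_mul => //; apply: cone_mul; last exact: cone_sinhquo.
  by apply: (@cone_cst (fun t => 2 / t)) => t t0; rewrite divr_ge0// ltW.
exists C => //; split=> // t s t0 s0; have [d le] := hC t s t0 s0.
have h : 0 < sinh (s / 2) by rewrite sinh_gt0// divr_gt0.
have k := cosh_gt0 (s / 2).
have hn := gt_eqF h; have kn := gt_eqF k; have tn := gt_eqF t0.
have g0 : 0 <= gauss t s by exact: expR_ge0.
have a0 := cone_ge0 ca t0 s0; have da0 := cone_ge0 cda t0 s0.
split.
- apply: (is_derive_eq (is_derive_cone_gauss Fa t0 s0 d)).
  rewrite eb// /b (sinh_double s); field.
  by rewrite ?hn ?kn ?tn.
- rewrite eb// Fa// mulrA ler_wpM2r// /b (sinh_double s) sinhquo0 -subr_ge0.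
  rewrite (_ : _ - _ = 4^-1 * da t s / cosh (s / 2)).
    by rewrite divr_ge0 ?mulr_ge0 ?invr_ge0// ltW.
  by field; rewrite hn kn tn.
- rewrite eb// Fa// mulrA ler_wpM2r// /b (sinh_double s) sinhquo0 -subr_ge0.
  rewrite (_ : _ - _ = (4^-1 * (C * a t s / cosh (s / 2) - da t s)
       + 3 / 4 * C * a t s / cosh (s / 2)) / cosh (s / 2)).
    apply: divr_ge0; last exact: ltW.
    by rewrite addr_ge0 ?divr_ge0 ?mulr_ge0 ?subr_ge0 ?invr_ge0// ltW.
  by field; rewrite hn kn tn.
Qed.

Definition heat_fam (m p : nat) (t : R) : R -> R :=
  iter p (@Dsinh R) (iter m (@Dsinh_half R) (gauss t)).

Lemma heat_fam_cone m p : exists2 a, cone a & cone_gauss (heat_fam m p) a.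
Proof.
elim: p => [|p [a ca ha]]; last by have [b cb [C C0 []]] := Dsinh_cone ca ha; exists b.
elim: m => [|m [a ca ha]]; last exact: (Dsinh_half_cone ca ha).
exists (fun _ _ => 1); first by apply: (@cone_cst (fun=> 1)).
by move=> t s _ _; rewrite mul1r.
Qed.

(** For the Gaussian E, the quotient D E / E is exactly half of this. *)
Definition rate (t s : R) : R := s / (t * sinh s).

(** The error term of the previous estimates is absorbed by the main one exactly in
the region of the theorem: (1 + s) / cosh^2 (s / 2) is bounded by a multiple of
s / sinh s, because sinh x <= x cosh x. *)
Lemma invr_cosh2_le (t s : R) : 0 < t -> 0 < s -> 1 <= (1 + s) / t ->
  (cosh (s / 2) ^+ 2)^-1 <= 3 * rate t s.
Proof.
move=> t0 s0; rewrite ler_pdivlMr// mul1r => ts.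
have h : 0 < sinh (s / 2) by rewrite sinh_gt0// divr_gt0.
have k := cosh_gt0 (s / 2).
have hn := gt_eqF h; have kn := gt_eqF k; have tn := gt_eqF t0.
have le1 : sinh (s / 2) <= s / 2 * cosh (s / 2).
  have s20 : 0 <= s / 2 by rewrite divr_ge0// ltW.
  by have := sinhquo_num_ge0 1 s20; rewrite /= subr_ge0.
have le2 := sinh_lt_cosh (s / 2).
rewrite /rate (sinh_double s) -subr_ge0.
set x := sinh _ in h hn le1 le2 *; set y := cosh _ in k kn le1 le2 *.
rewrite (_ : _ - _ = (3 * s * y - 2 * t * x) / (2 * t * x * y ^+ 2)); last first.
  by field; rewrite hn kn tn.
have [x0 y0 t1] := And3 (ltW h) (ltW k) (ltW t0); apply: divr_ge0; last by apply: mulr_ge0; [do 2!apply: mulr_ge0 => //|exact: sqr_ge0].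
have : t * x <= (1 + s) * x by rewrite ler_wpM2r// ltW.
have : s * x <= s * y by rewrite ler_wpM2l// ltW.
by nra.
Qed.

Lemma heat_fam_ratio m p : exists2 A : R, 0 < A & forall t s : R, 0 < t -> 0 < s ->
  [/\ 0 <= heat_fam m p t s,
      is_derive s 1 (heat_fam m p t) (- (sinh s * heat_fam m p.+1 t s)),
      rate t s / 2 * heat_fam m p t s <= heat_fam m p.+1 t s &
      1 <= (1 + s) / t ->
      heat_fam m p.+1 t s <= A * rate t s * heat_fam m p t s].
Proof.
have [a ca ha] := heat_fam_cone m p.
have [b cb [C C0 [hb hC]]] := Dsinh_cone ca ha.
exists (2^-1 + 3 * C); first by rewrite ltr_pwDl ?mulr_ge0.
move=> t s t0 s0; have [d l1 l2] := hC t s t0 s0.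
have F0 : 0 <= heat_fam m p t s.
  by rewrite ha// mulr_ge0 ?(cone_ge0 ca)// expR_ge0.
have e : s / (2 * t * sinh s) = rate t s / 2.
  by rewrite /rate; field; rewrite !gt_eqF// sinh_gt0.
split=> //; first by rewrite -e.
move=> ts; apply: le_trans l2 _; rewrite ler_wpM2r// e.
have := ler_wpM2l C0 (invr_cosh2_le t0 s0 ts).
by set u := _^-1; lra.
Qed.

End cone.

(** * The k-th derivative of the first function of a chain *)

Section expansion.
Context {R : realType}.
Implicit Types (f : nat -> R -> R) (x y : nat * nat * nat).

Definition chain f := forall i (s : R), 0 < s ->
  is_derive s 1 (f i) (- (sinh s * f i.+1 s)).

(** The triple (a, b, i) stands for (-1)^i sinh^a cosh^b f_i. Integer coefficients
are encoded by repetition, so that a positive coefficient is just membership in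
the list. *)
Definition dterm x : seq (nat * nat * nat) :=
  let: (a, b, i) := x in
  nseq a (a.-1, b.+1, i) ++ nseq b (a.+1, b.-1, i) ++ [:: (a.+1, b, i.+1)].

Definition dterms (k : nat) : seq (nat * nat * nat) :=
  iter k (fun s => flatten (map dterm s)) [:: (0, 0, 0)%N].

Definition eval_term f (r : R) x : R :=
  let: (a, b, i) := x in (- 1) ^+ i * sinh r ^+ a * cosh r ^+ b * f i r.

Lemma is_derive_eval_term f (r : R) x : chain f -> 0 < r ->
  is_derive r 1 (fun s => eval_term f s x) (\sum_(y <- dterm x) eval_term f r y).
Proof.
case: x => [[a b] i] cf r0; rewrite /= !big_cat big_seq1 !big_nseq !iter_addr_0 /=.
have d1 : is_derive r 1 (fun s => sinh s ^+ a) ((a%:R * sinh r ^+ a.-1) * cosh r).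
  by have := is_deriveX a (is_derive_sinh r); rewrite exprfctE.
have d2 : is_derive r 1 (fun s => cosh s ^+ b) ((b%:R * cosh r ^+ b.-1) * sinh r).
  by have := is_deriveX b (is_derive_cosh r); rewrite exprfctE.
have d3 := cf i r r0.
apply: is_derive_eq; rewrite /GRing.scale /= !exprS -[X in X + (_ + _)]mulr_natr -[X in _ + (X + _)]mulr_natr.
ring.
Qed.

Lemma is_derive_eval_terms f (r : R) (l : seq (nat * nat * nat)) :
  chain f -> 0 < r ->
  is_derive r 1 (fun s => \sum_(x <- l) eval_term f s x)
    (\sum_(y <- flatten (map dterm l)) eval_term f r y).
Proof.
move=> cf r0; elim: l => [|x l IH] /=.
  rewrite big_nil (_ : (fun _ => _) = cst 0); first exact: is_derive_cst.
  by apply/funext => s; rewrite big_nil.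
rewrite big_cat (_ : (fun _ => _) = (fun s => eval_term f s x) \+
  (fun s => \sum_(x <- l) eval_term f s x)); last first.
  by apply/funext => s; rewrite big_cons.
exact: (is_deriveD (is_derive_eval_term x cf r0) IH).
Qed.

Lemma derive1n_chain f k (r : R) : chain f -> 0 < r ->
  derive1n k (f 0) r = \sum_(x <- dterms k) eval_term f r x.
Proof.
move=> cf; elim: k r => [|k IH] r r0.
  by rewrite /= big_seq1 /= !mul1r.
rewrite derive1nS; apply: derive1_is_derive.
apply: (is_derive_eq_gt0 r0 IH).
exact: is_derive_eval_terms.
Qed.

(** Homogeneity, the parity of the power of [sinh], and its lower bound 2i - k:
each differentiation removes at most one factor [sinh], and raising the index i
adds one. *)
Definition term_inv (k : nat) x :=
  let: (a, b, i) := x in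
  [&& (a + b == i)%N, (i <= k)%N, odd a == odd k & (i.*2 <= a + k)%N].

Lemma dterm_inv k x y : term_inv k x -> y \in dterm x -> term_inv k.+1 y.
Proof.
case: x => [[a b] i] /and4P[/eqP ei ik /eqP pa ai].
rewrite !mem_cat !mem_nseq inE => /orP[/andP[a0 /eqP->]|/orP[/andP[b0 /eqP ->]|/eqP->]].
- case: a a0 ei pa ai => // a _ ei pa ai; apply/and4P; split => /=.
  + by rewrite addnS -addSn ei.
  + exact: leqW.
  + by rewrite /= -pa /= negbK.
  + by rewrite addnS -addSn.
- case: b b0 ei => // b _ ei; apply/and4P; split => /=.
  + by rewrite addSn -addnS ei.
  + exact: leqW.
  + by rewrite pa.
  + by rewrite (leq_trans ai)// leq_add// leqnSn.
- apply/and4P; split => /=.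
  + by rewrite addSn ei.
  + by [].
  + by rewrite pa.
  + by rewrite doubleS addSn addnS !ltnS.
Qed.

Lemma dterms_inv k x : x \in dterms k -> term_inv k x.
Proof.
elim: k x => [|k IH] x /=; first by rewrite inE => /eqP->.
by move=> /flatten_mapP[y /IH hy]; exact: dterm_inv.
Qed.

Lemma mem_dtermsS k x y : x \in dterms k -> y \in dterm x -> y \in dterms k.+1.
Proof. by move=> xk yx; apply/flatten_mapP; exists x. Qed.

Lemma mem_dterms_top k : (k, 0, k)%N \in dterms k.
Proof.
elim: k => [|k IH]; first by rewrite inE.
by apply: (mem_dtermsS IH); rewrite /dterm !mem_cat mem_seq1 eqxx !orbT.
Qed.

(** The dominant term for small r is present: alternately differentiate f_i and
the factor [sinh] that this has just produced. *)
Lemma mem_dterms_mid k : exists b, (odd k : nat, b, uphalf k) \in dterms k.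
Proof.
have h j : (0, j, j)%N \in dterms j.*2 /\ (1, j, j.+1)%N \in dterms j.*2.+1.
  elim: j => [|j [_ IH]]; first by rewrite !inE.
  have h0 : (0, j.+1, j.+1)%N \in dterms j.+1.*2.
    by apply: (mem_dtermsS IH); rewrite /= inE eqxx.
  by split=> //; apply: (mem_dtermsS h0); rewrite /dterm !mem_cat mem_seq1 eqxx !orbT.
have [h0 h1] := h k./2; case: (boolP (odd k)) => ko.
  exists k./2; rewrite uphalf_half ko add1n.
  by rewrite -[in dterms k](odd_double_half k) ko.
exists k./2; rewrite uphalf_half (negbTE ko) add0n.
by rewrite -[in dterms k](odd_double_half k) (negbTE ko).
Qed.

(** Terms selected by [P] share the sign [sg] and one of them reaches [m]; the
others are too small to compensate more than half of it. *)
Lemma sum_dominated (T : eqType) (l : seq T) (P : pred T) (v : T -> R)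
    (sg m eta : R) (x0 : T) :
  `|sg| = 1 -> 0 <= m -> 0 <= eta -> (size l)%:R * eta <= 2^-1 ->
  x0 \in l -> P x0 -> m <= sg * v x0 ->
  (forall z, z \in l -> P z -> 0 <= sg * v z) ->
  (forall z, z \in l -> ~~ P z -> `|v z| <= eta * m) ->
  m / 2 <= `| \sum_(z <- l) v z |.
Proof.
move=> sg1 m0 eta0 hl x0l Px0 mx0 hP hN.
have -> : `|\sum_(z <- l) v z| = `|sg * \sum_(z <- l) v z|.
  by rewrite normrM sg1 mul1r.
rewrite mulr_sumr; apply: le_trans (ler_norm _).
rewrite (bigID P) /=.
have h1 : m <= \sum_(z <- l | P z) sg * v z.
  rewrite (big_rem x0)//= Px0 (le_trans mx0)// lerDl big_seq_cond sumr_ge0// => z.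
  by move=> /andP[/mem_rem xl Px]; exact: hP.
have h2 : `|\sum_(z <- l | ~~ P z) sg * v z| <= (size l)%:R * (eta * m).
  apply: le_trans (ler_norm_sum _ _ _) _.
  rewrite big_seq_cond.
  apply: le_trans (_ : \sum_(z <- l | (z \in l) && ~~ P z) eta * m <= _).
    by apply: ler_sum => z /andP[xl Px]; rewrite normrM sg1 mul1r hN.
  rewrite big_const_seq iter_addr_0 -[leLHS]mulr_natl ler_wpM2r ?mulr_ge0//.
  by rewrite ler_nat count_size.
have h3 : (size l)%:R * (eta * m) <= m / 2.
  by rewrite mulrA [leRHS]mulrC ler_wpM2r.
move: h2; rewrite ler_norml => /andP[h2 _].
by apply: le_trans (lerD h1 h2); lra.
Qed.

Lemma iter_ratio_lower (F : nat -> R) (q : R) i d : 0 <= q ->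
  (forall j, (j < i + d)%N -> q * F j <= F j.+1) -> q ^+ d * F i <= F (i + d)%N.
Proof.
move=> q0; elim: d => [|d IH] h; first by rewrite expr0 mul1r addn0.
rewrite addnS exprS -mulrA (le_trans _ (h (i + d)%N _))//; last by rewrite addnS.
by rewrite ler_wpM2l// IH// => j jd; rewrite h// addnS ltnW.
Qed.

Lemma iter_ratio_upper (F : nat -> R) (q : R) i d : 0 <= q ->
  (forall j, (j < i + d)%N -> F j.+1 <= q * F j) -> F (i + d)%N <= q ^+ d * F i.
Proof.
move=> q0; elim: d => [|d IH] h; first by rewrite expr0 mul1r addn0.
rewrite addnS exprS -mulrA (le_trans (h (i + d)%N _))//; first by rewrite addnS.
by rewrite ler_wpM2l// IH// => j jd; rewrite h// addnS ltnW.
Qed.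

End expansion.

(** * The dominant terms for large and for small r *)

Section regimes.
Context {R : realType}.
Implicit Types (f : nat -> R -> R).

Lemma sinh_rate (t s : R) : 0 < t -> 0 < s -> sinh s * rate t s = s / t.
Proof. by move=> t0 s0; rewrite /rate; field; rewrite !gt_eqF// sinh_gt0. Qed.

Lemma norm_eval_term f (r : R) a b i : 0 < r -> 0 <= f i r ->
  `|eval_term f r (a, b, i)| = sinh r ^+ a * cosh r ^+ b * f i r.
Proof.
move=> r0 fi; rewrite /eval_term !normrM normrX normrN1 expr1n mul1r.
by rewrite !ger0_norm// exprn_ge0// ltW// ?sinh_gt0// cosh_gt0.
Qed.

Lemma sign_eval_term f (r : R) a b i :
  (-1) ^+ i * eval_term f r (a, b, i) = sinh r ^+ a * cosh r ^+ b * f i r.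
Proof. by rewrite /eval_term !mulrA -expr2 sqrr_sign mul1r. Qed.

Lemma uphalf_bounds k : (uphalf k <= k)%N /\ (k + odd k = (uphalf k).*2)%N.
Proof. by lia. Qed.

Lemma leq_exponent (al i j k o : nat) : (j < i)%N -> (k + o = j.*2)%N ->
  (i.*2 <= al + k)%N -> (o + 2 * (i - j) <= al)%N.
Proof. by lia. Qed.

(** The numbers sinh^i f_i grow at least geometrically with ratio a r / t, and the
only terms of index k are copies of (k, 0, k). *)
Lemma derive1n_chain_large k (a : R) : 0 < a -> exists2 X0 : R, 0 < X0 &
  forall f (r t : R), chain f -> 1 < r -> 0 < t -> X0 <= r / t ->
    (forall i, 0 <= f i r) -> (forall i, a * rate t r * f i r <= f i.+1 r) ->
    a ^+ k / 2 * ((r / t) ^+ k * f 0 r) <= `|derive1n k (f 0) r|.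
Proof.
move=> a0; pose M : R := 2 * (size (dterms k))%:R * 2 ^+ k.
have M0 : 0 <= M by rewrite !mulr_ge0// exprn_ge0.
(* the neglected terms then add up to at most half of the dominant one *)
exists ((M + 1) / a); first by rewrite divr_gt0// ltr_wpDl.
move=> f r t cf r1 t0 X0 f0 fS.
have r0 : 0 < r by exact: lt_trans r1.
have s0 := sinh_gt0 r0; have s0' := ltW s0.
set q := a * (r / t).
have qM : M + 1 <= q by rewrite /q mulrC -ler_pdivrMr.
have q1 : 1 <= q by apply: le_trans qM; rewrite lerDr.
have q0 : 0 < q by exact: lt_le_trans q1.
pose G i := sinh r ^+ i * f i r.
have G0 i : 0 <= G i by rewrite mulr_ge0// exprn_ge0.
have GS i : q * G i <= G i.+1.
  rewrite /G exprS -[leRHS]mulrA [leRHS]mulrCA /q -sinh_rate//.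
  have := ler_wpM2l (mulr_ge0 s0' (exprn_ge0 i s0')) (fS i).
  by congr (_ <= _); ring.
have cs : cosh r <= 2 * sinh r.
  have := cosh2_sinh2 r; have := ler_sinh (ltW r0); have := cosh_gt0 r; nra.
rewrite (derive1n_chain k cf r0).
apply: (@le_trans _ _ (G k / 2)).
  have := @iter_ratio_lower _ G q 0 k (ltW q0) (fun j _ => GS j).
  rewrite add0n /q exprMn {1}/G expr0 mul1r; lra.
apply: (@sum_dominated _ _ _ (fun x => x.2 == k) _ ((-1) ^+ k) _ (2 ^+ k / q) (k, 0, k)%N) => //.
- by rewrite normrX normrN1 expr1n.
- by rewrite divr_ge0 ?exprn_ge0// ltW.
- rewrite mulrA ler_pdivrMr//; move: qM; rewrite /M; lra.
- exact: mem_dterms_top.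
- by rewrite sign_eval_term expr0 mulr1.
- move=> [[al be] i] _ /= /eqP ->; rewrite sign_eval_term.
  by rewrite !mulr_ge0 ?exprn_ge0// ltW// cosh_gt0.
- move=> [[al be] i] /dterms_inv/and4P[/eqP ei ik _ _] /= nik.
  have {ik}nik : (i < k)%N by rewrite ltn_neqAle nik.
  rewrite norm_eval_term//.
  apply: (@le_trans _ _ (2 ^+ k * G i)).
    rewrite /G mulrA ler_wpM2r// -[in leRHS]ei exprD [leRHS]mulrCA ler_wpM2l ?exprn_ge0//.
    apply: (@le_trans _ _ ((2 * sinh r) ^+ be)).
      by rewrite lerXn2r // nnegrE ?(ltW (cosh_gt0 r)) // mulr_ge0.
    rewrite exprMn ler_wpM2r ?exprn_ge0//.
    by rewrite ler_weXn2l ?ler1n// (leq_trans _ (ltnW nik))// -ei leq_addl.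
  rewrite -mulrA ler_wpM2l ?exprn_ge0// mulrC ler_pdivlMr//.
  have := @iter_ratio_lower _ G q i (k - i) (ltW q0) (fun j _ => GS j).
  rewrite subnKC ?(ltnW nik)//; apply: le_trans.
  rewrite mulrC ler_wpM2r// -[leLHS]expr1 ler_weXn2l// subn_gt0//.
Qed.

(** Relative to the terms of index j = ceil (k / 2), an index i < j loses a factor
t, and an index i > j loses (r^2 / t)^(i - j): its extra power r^(2 (i - j))
outweighs the factor t^-(i - j) gained by f_i. *)
Lemma derive1n_chain_small k (a A : R) : 0 < a -> 0 < A ->
  exists2 eps : R, 0 < eps &
  forall f (r t : R), chain f -> 0 < r -> r <= 1 -> 0 < t -> t <= eps ->
    r ^+ 2 / t <= eps ->
    (forall i, 0 <= f i r) -> (forall i, a * rate t r * f i r <= f i.+1 r) ->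
    (forall i, (i < k)%N -> f i.+1 r <= A * rate t r * f i r) ->
    (a / cosh 1) ^+ (uphalf k) / 2 * (r ^+ odd k * t^-1 ^+ (uphalf k) * f 0 r) <=
    `|derive1n k (f 0) r|.
Proof.
move=> a0 A0; set K : R := cosh 1.
have K1 : 1 <= K := cosh_ge1 1.
have K0 : 0 < K by exact: lt_le_trans K1.
set b := a / K; have b0 : 0 < b by rewrite divr_gt0.
pose M : R := 2 * (size (dterms k))%:R * K ^+ k + 1.
have M1 : 1 <= M by rewrite lerDr !mulr_ge0// exprn_ge0// ltW.
have M0 : 0 < M by exact: lt_le_trans M1.
(* both small quantities t/b and A r^2/t are to be at most 1/M *)
exists (Num.min (b / M) (A^-1 / M)).
  by rewrite lt_min !divr_gt0// invr_gt0.
move=> f r t cf r0 r1 t0; rewrite !le_min => /andP[tb _] /andP[_ rA].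
move=> f0 fS fU; set j := uphalf k.
have s0 := sinh_gt0 r0; have rs := ler_sinh (ltW r0).
have c0 := cosh_gt0 r; have c1 := cosh_ge1 r.
have cK : cosh r <= K by rewrite ler_cosh// ltW.
have sK : sinh r <= K * r.
  have := sinhquo_num_ge0 1 (ltW r0); rewrite /= subr_ge0 => /le_trans; apply.
  by rewrite mulrC ler_wpM2r// ltW.
have lo i : b / t * f i r <= f i.+1 r.
  apply: le_trans (fS i); rewrite ler_wpM2r// /b -!mulrA ler_wpM2l ?(ltW a0)//.
  have ts0 := mulr_gt0 t0 s0; have Kt0 := mulr_gt0 K0 t0.
  rewrite /rate -invfM ler_pdivlMr// mulrC ler_pdivrMr//.
  rewrite (_ : r * (K * t) = t * (K * r)); [by rewrite ler_wpM2l ?(ltW t0)|by ring].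
have up i : (i < k)%N -> f i.+1 r <= A / t * f i r.
  move=> ik; apply: le_trans (fU i ik) _; rewrite ler_wpM2r// ler_wpM2l ?(ltW A0)//.
  by rewrite /rate ler_pdivrMr ?(mulr_gt0 t0 s0)// mulKf ?gt_eqF.
rewrite (derive1n_chain k cf r0).
have [jk ej] := uphalf_bounds k.
have bt0 : 0 <= b / t by rewrite divr_ge0// ltW.
have At0 : 0 <= A / t by rewrite divr_ge0// ltW.
pose m := r ^+ odd k * f j r.
have m0 : 0 <= m by rewrite mulr_ge0// exprn_ge0// ltW.
apply: (@le_trans _ _ (m / 2)).
  have := @iter_ratio_lower _ (f ^~ r) (b / t) 0 j bt0 (fun j _ => lo j).
  rewrite add0n exprMn => /(ler_wpM2l (exprn_ge0 (odd k) (ltW r0))).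
  rewrite /m; lra.
have [be hbe] := mem_dterms_mid k.
apply: (@sum_dominated _ _ _ (fun x => x.2 == j) _ ((-1) ^+ j) _ (K ^+ k / M)
   (odd k : nat, be, j)%N) => //.
- by rewrite normrX normrN1 expr1n.
- by rewrite divr_ge0 ?exprn_ge0// ltW.
- by rewrite mulrA ler_pdivrMr// /M; lra.
- rewrite sign_eval_term ler_wpM2r//.
  rewrite -[leLHS]mulr1 ler_pM ?exprn_ge0 ?(ltW r0)//.
    by rewrite lerXn2r// nnegrE ltW.
  exact: exprn_ege1.
- move=> [[al be'] i] _ /= /eqP ->; rewrite sign_eval_term.
  by rewrite !mulr_ge0 ?exprn_ge0// ltW.
- move=> [[al be'] i] /dterms_inv/and4P[/eqP ei ik /eqP par ali] /= nij.
  rewrite norm_eval_term//.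
  apply: (@le_trans _ _ (K ^+ k * (r ^+ al * f i r))).
    rewrite mulrA ler_wpM2r//.
    apply: (@le_trans _ _ ((K * r) ^+ al * K ^+ be')).
      have Kr0 : 0 <= K * r by rewrite mulr_ge0 ?ltW.
      apply: ler_pM; rewrite ?exprn_ge0 ?(ltW s0) ?(ltW c0)//.
        by rewrite lerXn2r ?nnegrE ?(ltW s0).
      by rewrite lerXn2r ?nnegrE ?(ltW c0) ?(ltW K0).
    rewrite exprMn mulrAC -exprD ei ler_wpM2r ?exprn_ge0 ?(ltW r0)//.
    by rewrite ler_weXn2l.
  rewrite -mulrA ler_wpM2l ?exprn_ge0 ?(ltW K0)//.
  rewrite [leRHS]mulrC ler_pdivlMr//.
  move: nij; rewrite neq_ltn => /orP[ij|ji].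
  + have ro : r ^+ al <= r ^+ odd k.
      rewrite ler_wiXn2l ?(ltW r0)// -par; by rewrite -[leqRHS]odd_double_half leq_addr.
    have bM : M <= b / t by rewrite ler_pdivlMr// mulrC -ler_pdivlMr.
    have := @iter_ratio_lower _ (f ^~ r) (b / t) i (j - i) bt0 (fun j _ => lo j).
    rewrite subnKC ?(ltnW ij)// => h.
    rewrite -mulrA; apply: ler_pM; rewrite ?exprn_ge0 ?mulr_ge0 ?(ltW r0) ?(ltW M0)//.
    apply: le_trans h; rewrite mulrC ler_wpM2r// (le_trans bM)//.
    by rewrite -[leLHS]expr1 ler_weXn2l ?subn_gt0// (le_trans M1).
  + have ro : r ^+ al <= r ^+ odd k * (r ^+ 2) ^+ (i - j).
      rewrite -exprM -exprD ler_wiXn2l ?(ltW r0)//.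
      exact: leq_exponent ji ej ali.
    have bM : r ^+ 2 * (A / t) <= M^-1.
      move: rA; rewrite -(ler_pM2l A0) [leRHS]mulrA mulfV ?gt_eqF// mul1r; apply: le_trans.
      by rewrite mulrCA.
    have M1' : M^-1 <= 1 by rewrite invf_le1.
    have := @iter_ratio_upper _ (f ^~ r) (A / t) j (i - j) At0.
    rewrite subnKC ?(ltnW ji)// => /(_ (fun l li => up l (leq_trans li ik))) h.
    have h2 : r ^+ al * f i r <= r ^+ odd k * (r ^+ 2 * (A / t)) ^+ (i - j) * f j r.
      apply: le_trans (ler_pM _ _ ro h) _; rewrite ?exprn_ge0 ?(ltW r0)//.
      by rewrite [(r ^+ 2 * _) ^+ _]exprMn; lra.
    apply: le_trans (ler_wpM2r (ltW M0) h2) _.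
    rewrite (mulrAC _ _ (f j r)) -[leLHS]mulrA -/m ler_piMr// -ler_pdivlMr// mul1r.
    have q0 : 0 <= r ^+ 2 * (A / t) by rewrite mulr_ge0// exprn_ge0// ltW.
    apply: (le_trans _ bM); rewrite -[leRHS]expr1 ler_wiXn2l ?subn_gt0//.
    exact: le_trans bM M1'.
Qed.
End regimes.

(** * Comparison with Psi *)

Section chain_lower.
Context {R : realType}.
Implicit Types (f : nat -> R -> R) (r t : R).

Lemma Psi_large_le k r t : 1 < r -> 0 < t -> 1 <= r / t ->
  Psi k r t <= 3 ^+ k * (r / t) ^+ k.
Proof.
move=> r1 t0 x1; rewrite /Psi (leNgt r 1) r1 /= -exprMn.
have st0 : 0 < Num.sqrt t by rewrite sqrtr_gt0.
have sx : (Num.sqrt t)^-1 <= r / t.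
  have [t1|t1] := leP 1 t.
    by apply: le_trans x1; rewrite invf_le1// -sqrtr1 ler_wsqrtr.
  have tt : t <= Num.sqrt t.
    rewrite -{1}(sqr_sqrtr (ltW t0)) expr2 ger_pMl//.
    by rewrite -sqrtr1 ler_wsqrtr// ltW.
  apply: (@le_trans _ _ t^-1); first by rewrite lef_pV2.
  by rewrite ler_peMl ?invr_ge0 ?ltW.
have q0 : 0 <= (Num.sqrt t)^-1 by rewrite invr_ge0 ltW.
by rewrite lerXn2r ?nnegrE//; lra.
Qed.

Lemma Psi_small_le k r t : 0 < r -> r <= 1 -> 0 < t -> t <= 1 -> r ^+ 2 / t <= 1 ->
  Psi k r t <= 2 * 3 ^+ k * (r ^+ odd k * t^-1 ^+ uphalf k).
Proof.
move=> r0 r1 t0 t1 rt.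
set q := (Num.sqrt t)^-1.
have st0 : 0 < Num.sqrt t by rewrite sqrtr_gt0.
have q0 : 0 < q by rewrite invr_gt0.
have q2 : t^-1 = q ^+ 2 by rewrite exprVn sqr_sqrtr ?ltW.
have q1 : 1 <= q by rewrite invf_ge1// -sqrtr1 ler_wsqrtr.
have rq : r * q <= 1.
  by rewrite -(@ler_pXn2r _ 2) ?nnegrE ?mulr_ge0 ?(ltW r0) ?(ltW q0)// exprMn expr1n -q2.
have hq : 0 <= 1 + q + r / t <= 3 * q.
  have : r / t <= q.
    by rewrite q2 expr2 mulrA ler_piMl// ltW.
  have : 0 <= r / t by rewrite divr_ge0// ltW.
  by lra.
have [h1 h2] := andP hq; rewrite /Psi r1 /= -/q.
have hX n : (1 + q + r / t) ^+ n <= 3 ^+ n * q ^+ n.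
  by rewrite -exprMn lerXn2r ?nnegrE// mulr_ge0// ltW.
set w := 1 + q + r / t in hq h1 h2 hX *.
have p3 n : 0 <= (3 : R) ^+ n by rewrite exprn_ge0.
have pq n : 0 <= q ^+ n by rewrite exprn_ge0// ltW.
case: (boolP (odd k)) => ko.
  have [l ek] : exists l, k = l.*2.+1 by exists k./2; rewrite -[LHS]odd_double_half ko.
  rewrite ek /= doubleK q2 -exprM.
  have -> : q ^+ (2 * l.+1) = q ^+ l.*2 * q ^+ 2 by rewrite -exprD -addnn mul2n doubleS -addnn addn2.
  have u : 1 + q ^+ 2 <= 2 * q ^+ 2.
    by have := exprn_ege1 2 q1; lra.
  have v := hX l.*2.
  rewrite -mulrA [leRHS]mulrCA ler_wpM2l ?(ltW r0)//.
  apply: (@le_trans _ _ ((3 ^+ l.*2 * q ^+ l.*2) * (2 * q ^+ 2))).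
    apply: ler_pM => //; first exact: exprn_ge0.
    by rewrite addr_ge0 ?sqr_ge0.
  rewrite [3 ^+ l.*2.+1]exprS.
  have := mulr_ge0 (mulr_ge0 (p3 l.*2) (pq l.*2)) (pq 2%N).
  by lra.
rewrite expr0 mul1r q2 -exprM.
have -> : (2 * uphalf k = k)%N.
  by rewrite uphalf_half (negbTE ko) add0n mul2n -[RHS]odd_double_half (negbTE ko).
apply: le_trans (hX k) _.
have := mulr_ge0 (p3 k) (pq k); lra.
Qed.

(** The hypothesis gives r^alpha < t, hence r^2 / t < t^(2 / alpha - 1), and the
exponent is positive. *)
Lemma parabolic_small (alpha eps : R) : 1 <= alpha -> alpha < 2 -> 0 < eps ->
  exists2 T : R, 0 < T & forall r t, 0 < r -> 0 < t -> t <= T ->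
    r `^ alpha * (1 + (1 + r) / t) < 1 -> r ^+ 2 / t <= eps.
Proof.
move=> a1 a2 e0.
have a0 : 0 < alpha by exact: lt_le_trans a1.
have b0 : 0 < 2 / alpha - 1 by rewrite subr_gt0 ltr_pdivlMr// mul1r.
set b := 2 / alpha - 1 in b0.
exists (eps `^ b^-1); first exact: powR_gt0.
move=> r t r0 t0 tT h.
have ra0 : 0 < r `^ alpha by exact: powR_gt0.
have rat : r `^ alpha <= t.
  rewrite -[leRHS]mul1r -ler_pdivrMr// ltW//; apply: le_lt_trans h.
  rewrite ler_wpM2l ?(ltW ra0)//.
  have : t^-1 <= (1 + r) / t by rewrite ler_peMl ?invr_ge0 ?(ltW t0)//; lra.
  lra.
have r2 : r ^+ 2 <= t * t `^ b.
  have -> : r ^+ 2 = (r `^ alpha) `^ (2 / alpha).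
    rewrite -powRrM mulrCA mulfV ?gt_eqF// mulr1 powR_mulrn// ltW//.
  have -> : t * t `^ b = t `^ (2 / alpha).
    rewrite -{1}(powRr1 (ltW t0)) -powRD ?subrKC//.
    by rewrite (gt_eqF t0) implybT.
  by rewrite ge0_ler_powR ?nnegrE ?divr_ge0// ltW.
rewrite ler_pdivrMr// mulrC; apply: le_trans r2 _; rewrite ler_wpM2l ?(ltW t0)//.
have -> : eps = (eps `^ b^-1) `^ b by rewrite -powRrM mulVf ?gt_eqF// powRr1// ltW.
by rewrite ge0_ler_powR ?nnegrE ?powR_ge0// ltW.
Qed.

Theorem derive1n_chain_lower k (alpha a A : R) :
  1 <= alpha -> alpha < 2 -> 0 < a -> 0 < A ->
  exists2 gamma : R, 0 < gamma & exists2 c : R, 0 < c &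
  forall f r t, 0 < r -> 0 < t -> gamma <= (1 + r) / t ->
    1 < r \/ r `^ alpha * (1 + (1 + r) / t) < 1 ->
    chain f -> (forall i, 0 <= f i r) ->
    (forall i, a * rate t r * f i r <= f i.+1 r) ->
    (forall i, (i < k)%N -> f i.+1 r <= A * rate t r * f i r) ->
    c * (Psi k r t * f 0 r) <= `|derive1n k (f 0) r|.
Proof.
move=> al1 al2 a0 A0.
have [X X0 hX] := derive1n_chain_large k a0.
have [eps e0 hS] := derive1n_chain_small k a0 A0.
have m0 : 0 < Num.min eps 1 by rewrite lt_min e0 ltr01.
have [T T0 hT] := parabolic_small al1 al2 m0.
set T1 := Num.min (Num.min eps 1) T.
have T10 : 0 < T1 by rewrite lt_min m0 T0.
(* the first summand makes r / t large when r > 1, the second makes t small when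
   r <= 1 *)
exists (2 * (1 + X) + 2 / T1).
  by apply: addr_gt0; [apply: mulr_gt0 => //; exact: addr_gt0|exact: divr_gt0].
set c1 := a ^+ k / 2 / 3 ^+ k.
set c2 := (a / cosh 1) ^+ uphalf k / 2 / (2 * 3 ^+ k).
have c10 : 0 < c1 by rewrite !divr_gt0// exprn_gt0.
have c20 : 0 < c2.
  by rewrite /c2 !divr_gt0// ?mulr_gt0// exprn_gt0// divr_gt0// cosh_gt0.
exists (Num.min c1 c2); first by rewrite lt_min c10.
move=> f r t r0 t0 g cond cf f0 fS fU.
have P0 : 0 <= Psi k r t.
  have q0 : 0 <= 1 + (Num.sqrt t)^-1 + r / t.
    by rewrite !addr_ge0// ?divr_ge0 ?invr_ge0 ?sqrtr_ge0// ltW.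
  rewrite /Psi; case: ifP => _; rewrite ?mulr_ge0 ?exprn_ge0 ?(ltW r0)//.
  by rewrite addr_ge0// invr_ge0 ltW.
have [r1|r1] := ltP 1 r.
  have xX : 1 + X <= r / t.
    have t1 : 0 < t^-1 by rewrite invr_gt0.
    have : (1 + r) / t <= 2 * (r / t) by rewrite mulrA ler_wpM2r ?(ltW t1)//; lra.
    have : 0 < 2 / T1 by rewrite divr_gt0.
    lra.
  have hP : Psi k r t <= 3 ^+ k * (r / t) ^+ k by apply: Psi_large_le => //; lra.
  apply: le_trans (hX f r t cf r1 t0 _ f0 fS); last by lra.
  apply: (@le_trans _ _ (c1 * (Psi k r t * f 0 r))).
    by rewrite ler_wpM2r ?mulr_ge0// ge_min lexx.
  rewrite /c1 -[leLHS]mulrA ler_wpM2l ?divr_ge0 ?exprn_ge0 ?(ltW a0)//.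
  by rewrite ler_pdivrMl ?exprn_gt0// mulrA ler_wpM2r.
have {cond}cond : r `^ alpha * (1 + (1 + r) / t) < 1.
  by case: cond => //; rewrite ltNge r1.
have tT1 : t <= T1.
  have h1 : 2 / T1 <= (1 + r) / t by apply: le_trans g; lra.
  have h2 : (1 + r) / t <= 2 / t by rewrite ler_wpM2r ?invr_ge0 ?(ltW t0)//; lra.
  have := le_trans h1 h2; rewrite ler_pM2l// lef_pV2// ?posrE//.
move: tT1; rewrite /T1 !le_min => /andP[/andP[te t1] tT].
have := hT r t r0 t0 tT cond; rewrite le_min => /andP[rte rt1].
have hP := Psi_small_le k r0 r1 t0 t1 rt1.
apply: le_trans (hS f r t cf r0 r1 t0 te rte f0 fS fU).
apply: (@le_trans _ _ (c2 * (Psi k r t * f 0 r))).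
  by rewrite ler_wpM2r ?mulr_ge0// ge_min lexx orbT.
have b0 : 0 <= a / cosh 1 by rewrite ltW// divr_gt0// cosh_gt0.
rewrite /c2 -[leLHS]mulrA ler_wpM2l ?(divr_ge0 (exprn_ge0 _ b0))//.
by rewrite ler_pdivrMl ?mulr_gt0 ?exprn_gt0// mulrA ler_wpM2r.
Qed.

End chain_lower.

(** * The inverse hyperbolic cosine *)

Section acosh.
Context {R : realType}.
Implicit Types (y s t : R).

Definition acosh y : R := ln (y + Num.sqrt (y ^+ 2 - 1)).

Lemma acosh_arg_gt0 y : 1 <= y -> 1 <= y + Num.sqrt (y ^+ 2 - 1).
Proof. by move=> y1; have := sqrtr_ge0 (y ^+ 2 - 1); lra. Qed.

Lemma cosh_acosh y : 1 <= y -> cosh (acosh y) = y.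
Proof.
move=> y1; have := acosh_arg_gt0 y1; rewrite /cosh /acosh expRN.
have s2 : 0 <= y ^+ 2 - 1 by have := exprn_ege1 2 y1; lra.
have := sqr_sqrtr s2; set q := Num.sqrt _ => q2 q1.
have q0 : 0 < y + q by lra.
rewrite lnK ?posrE//.
have -> : (y + q)^-1 = y - q.
  apply: (mulfI (lt0r_neq0 q0)); rewrite divff ?lt0r_neq0//.
  have -> : (y + q) * (y - q) = y ^+ 2 - q ^+ 2 by ring.
  by rewrite q2; ring.
by field.
Qed.

Lemma acosh_cosh s : 0 <= s -> acosh (cosh s) = s.
Proof.
move=> s0; have sh : 0 <= sinh s by apply: le_trans s0 (ler_sinh s0).
rewrite /acosh cosh2_sinh2 addrAC subrr add0r sqrtr_sqr ger0_norm//.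
by rewrite cosh_sinh_expR expRK.
Qed.

Lemma acosh_homo y1 y2 : 1 <= y1 -> y1 <= y2 -> acosh y1 <= acosh y2.
Proof.
move=> h1 h12; have h2 := le_trans h1 h12.
rewrite ler_ln ?posrE ?(lt_le_trans ltr01 (acosh_arg_gt0 _))//.
rewrite lerD// ler_wsqrtr// lerD2r lerXn2r ?nnegrE//; exact: le_trans ler01 _.
Qed.

Lemma acosh_gt0 y : 1 < y -> 0 < acosh y.
Proof.
by move=> y1; rewrite ln_gt0//; have := sqrtr_ge0 (y ^+ 2 - 1); lra.
Qed.

Lemma sinh_acosh y : 1 < y -> sinh (acosh y) = Num.sqrt (y ^+ 2 - 1).
Proof.
move=> y1; have s0 := sinh_gt0 (acosh_gt0 y1).
by rewrite -{2}(cosh_acosh (ltW y1)) cosh2_sinh2 addrAC subrr add0r sqrtr_sqr gtr0_norm.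
Qed.

Lemma is_derive_acosh y : 1 < y -> is_derive y 1 acosh (sinh (acosh y))^-1.
Proof.
move=> y1; rewrite sinh_acosh//.
have s2 : 0 < y ^+ 2 - 1 by rewrite (_ : _ - _ = (y - 1) * (y + 1)); [rewrite mulr_gt0//; lra|ring].
have d0 : is_derive y 1 (fun x : R => x ^+ 2 - 1) (2 * y).
  by apply: is_derive_eq; rewrite /GRing.scale /=; ring.
have d1 := is_derive1_comp (g := fun x : R => x ^+ 2 - 1) (is_derive1_sqrt s2) d0.
have d2 : is_derive y 1 (fun x : R => x + Num.sqrt (x ^+ 2 - 1))
    (1 + y / Num.sqrt (y ^+ 2 - 1)).
  apply: (is_derive_eq (is_deriveD (is_derive_id y 1) d1)).
  by field; rewrite gt_eqF// sqrtr_gt0.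
have p : 0 < y + Num.sqrt (y ^+ 2 - 1).
  exact: lt_le_trans (acosh_arg_gt0 (ltW y1)).
apply: (is_derive_eq (is_derive1_comp (g := fun x : R => x + Num.sqrt (x ^+ 2 - 1)) (is_derive1_ln p) d2)).
have q0 : 0 < Num.sqrt (y ^+ 2 - 1) by rewrite sqrtr_gt0.
by field; rewrite !gt_eqF.
Qed.

Lemma is_derive_chain_acosh (f : nat -> R -> R) i y : chain f -> 1 < y ->
  is_derive y 1 (fun x => f i (acosh x)) (- f i.+1 (acosh y)).
Proof.
move=> cf y1; have s0 := acosh_gt0 y1.
apply: (is_derive_eq (is_derive1_comp (g := acosh) (cf i _ s0) (is_derive_acosh y1))).
by field; rewrite gt_eqF// sinh_gt0.
Qed.

(** The lower bound on the ratio says that the logarithmic derivative of f_i is at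
most that of the Gaussian, so f_i divided by the Gaussian is nonincreasing. *)
Lemma chain_decay (f : nat -> R -> R) i t (s1 s2 : R) : chain f -> 0 < t ->
  (forall s, 0 < s -> rate t s / 2 * f i s <= f i.+1 s) ->
  0 < s1 -> s1 <= s2 -> f i s2 <= f i s1 * expR (- ((s2 ^+ 2 - s1 ^+ 2) / (4 * t))).
Proof.
move=> cf t0 hf s10 s12.
pose E (x : R) := expR (x ^+ 2 / (4 * t)).
have dE (x : R) : is_derive x 1 E (x / (2 * t) * E x).
  rewrite /E; apply: is_derive_eq; rewrite /GRing.scale /=; field.
  by rewrite gt_eqF.
have dh (x : R) : 0 < x -> is_derive x 1 (fun x => f i x * E x)
    (- (sinh x * (f i.+1 x - rate t x / 2 * f i x)) * E x).
  move=> x0; have d1 := cf i x x0; have d2 := dE x.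
  apply: is_derive_eq; rewrite /GRing.scale /= /rate; field.
  by rewrite !gt_eqF// sinh_gt0.
have pos (x : R) : x \in `[s1, s2] -> 0 < x.
  by rewrite in_itv/= => /andP[h _]; exact: lt_le_trans h.
have cont : {within `[s1, s2], continuous (fun x => f i x * E x)}.
  by apply: derivable_within_continuous => x /pos x0; exact: (@ex_derive _ _ _ _ _ _ _ (dh x x0)).
have [c /pos c0] := MVT_segment s12
  (fun x hx => dh x (pos x (subset_itv_oo_cc hx))) cont.
have E0 x : 0 < E x by exact: expR_gt0.
have : 0 <= sinh c * (f i.+1 c - rate t c / 2 * f i c) * E c * (s2 - s1).
  have sc := ltW (sinh_gt0 c0); have ec := ltW (E0 c).
  apply: mulr_ge0; last by rewrite subr_ge0.
  by apply: mulr_ge0 => //; apply: mulr_ge0 => //; rewrite subr_ge0 hf.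
rewrite !mulNr => h /eqP; rewrite subr_eq => /eqP e.
have {}h : f i s2 * E s2 <= f i s1 * E s1 by rewrite e; lra.
have -> : expR (- ((s2 ^+ 2 - s1 ^+ 2) / (4 * t))) = E s1 / E s2.
  by rewrite /E -expRN -expRD; congr expR; field; rewrite gt_eqF.
by rewrite mulrA ler_pdivlMr.
Qed.

End acosh.

(** * The substitution cosh s = cosh r + v^2 *)

Section abel_substitution.
Context {R : realType}.
Implicit Types (y s t r v : R).
Local Notation mu := (@lebesgue_measure R).

Lemma acosh_lt y1 y2 : 1 <= y1 -> y1 < y2 -> acosh y1 < acosh y2.
Proof.
move=> h1 h12; rewrite lt_neqAle acosh_homo ?(ltW h12)// andbT.
apply/eqP => e; have h2 := le_trans h1 (ltW h12); move: h12.
by rewrite -(cosh_acosh h1) e cosh_acosh ?ltxx.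
Qed.

Definition shell r v : R := acosh (cosh r + v ^+ 2).

(** The weight that the half-integral gives to s; it is singular at s = r. *)
Definition abel_kernel r s : R := sinh s / Num.sqrt (cosh s - cosh r).

Lemma shell_arg_gt1 r v : 0 < r -> 1 < cosh r + v ^+ 2.
Proof. by move=> /cosh_gt1; have := sqr_ge0 v; lra. Qed.

Lemma cosh_shell r v : 0 < r -> cosh (shell r v) = cosh r + v ^+ 2.
Proof. by move=> r0; rewrite cosh_acosh// ltW// shell_arg_gt1. Qed.

Lemma shell_gt0 r v : 0 < r -> 0 < shell r v.
Proof. by move=> r0; rewrite acosh_gt0// shell_arg_gt1. Qed.

Lemma shell_lt r v1 v2 : 0 < r -> 0 <= v1 -> v1 < v2 -> shell r v1 < shell r v2.
Proof.
move=> r0 v10 v12; apply: acosh_lt; first exact/ltW/shell_arg_gt1.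
by rewrite ltrD2l ltrXn2r// ?nnegrE// ltW// (le_lt_trans v10).
Qed.

Lemma shell_le r v1 v2 : 0 < r -> 0 <= v1 -> v1 <= v2 -> shell r v1 <= shell r v2.
Proof.
move=> r0 v10 v12; apply: acosh_homo; first exact/ltW/shell_arg_gt1.
by rewrite lerD2l lerXn2r// nnegrE (le_trans v10).
Qed.

Lemma shell0 r : 0 < r -> shell r 0 = r.
Proof. by move=> r0; rewrite /shell expr0n addr0 acosh_cosh// ltW. Qed.

Lemma shell_gt r v : 0 < r -> 0 < v -> r < shell r v.
Proof. by move=> r0 v0; rewrite -{1}(shell0 r0) shell_lt. Qed.

Lemma shell_ge r v : 0 < r -> 0 <= v -> r <= shell r v.
Proof.
by move=> r0 v0; rewrite -{1}(shell0 r0) shell_le.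
Qed.

Lemma is_derive_shell r v : 0 < r ->
  is_derive v 1 (shell r) (2 * v / sinh (shell r v)).
Proof.
move=> r0; have h := shell_arg_gt1 v r0.
have d : is_derive v 1 (fun x : R => cosh r + x ^+ 2) (2 * v).
  by apply: is_derive_eq; rewrite /GRing.scale /=; ring.
apply: (is_derive_eq (is_derive1_comp (g := fun x : R => cosh r + x ^+ 2) (is_derive_acosh h) d)).
by rewrite mulrC.
Qed.

Lemma continuous_shell r v : 0 < r -> {for v, continuous (shell r)}.
Proof. by move=> r0; exact: is_derive_continuous (is_derive_shell v r0). Qed.

Lemma continuous_derive1_shell r v : 0 < r -> {for v, continuous (derive1 (shell r))}.
Proof.
move=> r0.
have -> : derive1 (shell r) = fun v => 2 * v / sinh (shell r v).
  by apply/funext => x; exact: derive1_is_derive (is_derive_shell x r0).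
have s0 : sinh (shell r v) != 0 by rewrite gt_eqF// sinh_gt0// acosh_gt0// shell_arg_gt1.
have ds := is_derive_shell v r0.
have d1 := is_derive1_comp (is_derive_sinh (shell r v)) ds.
have d2 := @is_deriveV _ (@sinh R \o shell r) _ _ _ s0 d1.
have d3 : is_derive v 1 (fun x : R => 2 * x) 2.
  by apply: is_derive_eq; rewrite /GRing.scale /=; ring.
exact: is_derive_continuous (is_deriveM d3 d2).
Qed.

Lemma sqr_le_sinh_shell r v : 0 < r -> v ^+ 2 <= sinh (shell r v).
Proof.
move=> r0; have h := shell_arg_gt1 v r0.
rewrite sinh_acosh// -[leLHS](ger0_norm (sqr_ge0 v)) -sqrtr_sqr ler_wsqrtr//.
have := cosh_gt1 r0; have := sqr_ge0 v; move: (v ^+ 2) (cosh r) => w c w0 c1.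
have cw : 0 <= c * w by rewrite mulr_ge0// ltW// (lt_trans ltr01).
have : 0 <= (c - 1) * (c + 1) by rewrite mulr_ge0; lra.
by lra.
Qed.

Lemma cvg_shell_pinfty r : 0 < r -> shell r v @[v --> +oo%R] --> +oo%R.
Proof.
move=> r0; apply/cvgryPge => M; near=> v.
have v1 : 1 <= v by near: v; exact: nbhs_pinfty_ge.
have vM : expR M <= v by near: v; exact: nbhs_pinfty_ge.
have h := shell_arg_gt1 v r0.
rewrite -(expRK M) ler_ln ?posrE ?expR_gt0//; last first.
  by apply: lt_le_trans (acosh_arg_gt0 (ltW h)).
have := cosh_gt0 r; have := sqrtr_ge0 ((cosh r + v ^+ 2) ^+ 2 - 1).
have : v <= v ^+ 2 by rewrite expr2 ler_peMl// (le_trans ler01).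
lra.
Unshelve. all: end_near. Qed.

Lemma cvg_derive1_shell_pinfty r : 0 < r ->
  derive1 (shell r) v @[v --> +oo%R] --> 0.
Proof.
move=> r0.
apply: (@squeeze_cvgr _ _ _ _ (cst 0) (fun v => 2 * v^-1)).
- near=> v.
  have v0 : 0 < v by near: v; exact: nbhs_pinfty_gt.
  have s0 : 0 < sinh (shell r v) by rewrite sinh_gt0// acosh_gt0// shell_arg_gt1.
  rewrite (derive1_is_derive (is_derive_shell v r0)) (divr_ge0 _ (ltW s0)) ?mulr_ge0 ?(ltW v0)//=.
  rewrite ler_pdivrMr// -mulrA ler_wpM2l// ler_pdivlMl// -expr2.
  exact: sqr_le_sinh_shell.
- exact: cvg_cst.
- have h : \forall v \near +oo%R, 0 < (v : R) by exact: nbhs_pinfty_gt.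
  have hV : (fun v : R => v^-1) v @[v --> +oo%R] --> 0.
    exact: ((gtr0_cvgV0 h).2 cvg_id).
  by rewrite -[X in _ --> X](mulr0 (2 : R)); apply: cvgM hV; exact: cvg_cst.
Unshelve. all: end_near. Qed.

End abel_substitution.

Section abel_change_of_variable.
Context {R : realType}.
Implicit Types (y s t r v : R).
Local Notation mu := (@lebesgue_measure R).

Lemma continuous_abel_kernel r s : 0 < r -> r < s ->
  {for s, continuous (abel_kernel r)}.
Proof.
move=> r0 rs; have h : 0 < cosh s - cosh r by rewrite subr_gt0 ltr_cosh// ltW.
have q0 : Num.sqrt (cosh s - cosh r) != 0 by rewrite gt_eqF// sqrtr_gt0.
have d0 : is_derive s 1 (fun x => cosh x - cosh r) (sinh s).
  by apply: is_derive_eq; rewrite subr0.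
have d1 := is_derive1_comp (g := fun x => cosh x - cosh r) (is_derive1_sqrt h) d0.
have d2 := @is_deriveV _ (fun x => Num.sqrt (cosh x - cosh r)) _ _ _ q0 d1.
exact: is_derive_continuous (is_deriveM (is_derive_sinh s) d2).
Qed.

(** Away from the singularity at s = r, which corresponds to v = 0, the usual
change of variables applies. *)
Lemma abel_substitution_ge (F : R -> R) r (d : R) : 0 < r -> 0 < d ->
  (forall s, 0 < s -> {for s, continuous F}) -> (forall s, 0 < s -> 0 <= F s) ->
  (\int[mu]_(s in `[shell r d, +oo[) (abel_kernel r s * F s)%:E =
   \int[mu]_(v in `[d, +oo[) (2 * F (shell r v))%:E)%E.
Proof.
move=> r0 d0 cF F0.
have rd := shell_gt r0 d0.
have cG s : r < s -> {for s, continuous (fun s => abel_kernel r s * F s)}.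
  move=> rs; apply: continuousM; first exact: continuous_abel_kernel.
  by apply: cF; exact: lt_trans rs.
have posI x : x \in `[d, +oo[ -> 0 < x.
  by rewrite in_itv/= andbT; exact: lt_le_trans.
rewrite (@increasing_ge0_integration_by_substitutiony _ (shell r)).
- apply: eq_integral => v; rewrite inE => /posI v0.
  have s0 : 0 < sinh (shell r v) by rewrite sinh_gt0// acosh_gt0// shell_arg_gt1.
  rewrite !fctE (derive1_is_derive (is_derive_shell v r0)) /abel_kernel cosh_shell//.
  rewrite addrC addKr sqrtr_sqr gtr0_norm//.
  by congr EFin; field; rewrite !gt_eqF.
- move=> x y /posI x0 /posI y0 xy; exact: shell_lt (ltW x0) xy.
- by move=> x _; exact: continuous_derive1_shell.
- apply/cvg_ex; exists (derive1 (shell r) d); apply: cvg_at_right_filter.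
  exact: continuous_derive1_shell.
- by apply/cvg_ex; exists 0; exact: cvg_derive1_shell_pinfty.
- split; first by move=> x _; exact: (@ex_derive _ _ _ _ _ _ _ (is_derive_shell x r0)).
  by apply: cvg_at_right_filter; exact: continuous_shell.
- exact: cvg_shell_pinfty.
- apply/continuous_within_itvcyP; split.
    move=> x; rewrite in_itv/= andbT => dx; apply: cG; exact: lt_trans dx.
  by apply: cvg_at_right_filter; exact: cG.
- move=> x; rewrite in_itv/= andbT => dx.
  have rx := lt_trans rd dx; have x0 := lt_trans r0 rx.
  rewrite mulr_ge0 ?F0// /abel_kernel divr_ge0 ?sqrtr_ge0//.
  exact/ltW/sinh_gt0.
Qed.

Lemma bigcup_itv_cvg (u : nat -> R) (a : R) : (forall n, a < u n) ->
  (u n @[n --> \oo] --> a) -> \bigcup_n `[u n, +oo[%classic = `]a, +oo[%classic.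
Proof.
move=> ua cu; apply/seteqP; split=> [x [n _]|x] /=; rewrite !in_itv/= !andbT.
  exact: lt_le_trans.
move=> ax; have := cu; move/cvgr_lt => /(_ _ ax) [n _ hn].
by exists n => //=; rewrite in_itv/= andbT; apply/ltW/hn => /=.
Qed.

(** The singular endpoint is reached by monotone convergence along the cutoffs
v >= 1 / (n + 1). *)
Lemma abel_substitution (F : R -> R) r : 0 < r ->
  (forall s, 0 < s -> {for s, continuous F}) -> (forall s, 0 < s -> 0 <= F s) ->
  (\int[mu]_(s in `]r, +oo[) (abel_kernel r s * F s)%:E =
   \int[mu]_(v in `]0%R, +oo[) (2 * F (shell r v))%:E)%E.
Proof.
move=> r0 cF F0.
pose u (n : nat) : R := n.+1%:R^-1.
have u0 n : 0 < u n by rewrite invr_gt0.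
have u_anti m n : (m <= n)%N -> u n <= u m.
  by move=> mn; rewrite lef_pV2 ?posrE// ler_nat.
have cu : u n @[n --> \oo] --> (0 : R) by exact: cvg_harmonic.
have mG : measurable_fun `]r, +oo[%classic (fun s => (abel_kernel r s * F s)%:E).
  apply/measurable_EFinP; apply: open_continuous_measurable_fun; first exact: interval_open.
  move=> s; rewrite inE/= in_itv/= andbT => rs.
  apply: continuousM; first exact: continuous_abel_kernel.
  by apply: cF; exact: lt_trans rs.
have mH : measurable_fun (`]0, +oo[%classic : set R) (fun v => (2 * F (shell r v))%:E).
  apply/measurable_EFinP; apply: open_continuous_measurable_fun; first exact: interval_open.
  move=> v; rewrite inE/= in_itv/= andbT => v0.
  apply: (@cvgM _ _ _ _ (cst 2)); first exact: cvg_cst.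
  apply: continuous_comp; first exact: continuous_shell.
  by apply: cF; rewrite acosh_gt0// shell_arg_gt1.
have sub1 n : `[shell r (u n), +oo[%classic `<=` `]r, +oo[%classic.
  by move=> x /=; rewrite !in_itv/= !andbT; apply: lt_le_trans; exact: shell_gt.
have sub2 n : `[u n, +oo[%classic `<=` (`]0, +oo[%classic : set R).
  by move=> x /=; rewrite !in_itv/= !andbT; exact: lt_le_trans.
(* the cutoffs v >= u n correspond to s >= shell r (u n), which decreases to r *)
have cs : (shell r \o u) n @[n --> \oo] --> r.
  have := cvg_comp _ _ cu (@continuous_shell _ r 0 r0); rewrite shell0//; exact.
have e1 := @bigcup_itv_cvg (shell r \o u) r (fun n => shell_gt r0 (u0 n)) cs.
have e2 := @bigcup_itv_cvg u 0 u0 cu.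
have l1 : (\int[mu]_(s in `[shell r (u n), +oo[) (abel_kernel r s * F s)%:E)%E @[n --> \oo]
    --> (\int[mu]_(s in `]r, +oo[) (abel_kernel r s * F s)%:E)%E.
  rewrite -e1.
  apply: ge0_nondecreasing_set_cvg_integral.
  - move=> m n mn; rewrite subsetEset; apply: subset_itvr; rewrite bnd_simp.
    by apply: shell_le => //; [exact/ltW/u0|exact: u_anti].
  - by move=> n; exact: measurable_itv.
  - by move=> n; apply: measurable_funS (sub1 n) mG; exact: measurable_itv.
  - move=> n x /sub1 /=; rewrite in_itv/= andbT => rx; have x0 := lt_trans r0 rx.
    rewrite lee_fin mulr_ge0 ?F0// /abel_kernel divr_ge0 ?sqrtr_ge0//.
    exact/ltW/sinh_gt0.
have l2 : (\int[mu]_(v in `[u n, +oo[) (2 * F (shell r v))%:E)%E @[n --> \oo]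
    --> (\int[mu]_(v in `]0%R, +oo[) (2 * F (shell r v))%:E)%E.
  rewrite -e2; apply: ge0_nondecreasing_set_cvg_integral.
  - by move=> m n mn; rewrite subsetEset; apply: subset_itvr; rewrite bnd_simp; exact: u_anti.
  - by move=> n; exact: measurable_itv.
  - by move=> n; apply: measurable_funS (sub2 n) mH; exact: measurable_itv.
  - move=> n x _; rewrite lee_fin mulr_ge0// F0// acosh_gt0// shell_arg_gt1//.
have e n := abel_substitution_ge r0 (u0 n) cF F0.
rewrite (eq_fun e) in l1.
exact: (cvg_unique (@ereal_hausdorff R) l1 l2).
Qed.

End abel_change_of_variable.

(** * The half-integral maps chains to chains *)

Section abel_chain.
Context {R : realType}.
Implicit Types (s r v : R).
Local Notation mu := (@lebesgue_measure R).

Definition abel (F : R -> R) r : R :=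
  \int[mu]_(s in `]r, +oo[) (abel_kernel r s * F s).

Lemma integrable_oneDsqrV :
  mu.-integrable (`]0, +oo[%classic : set R) (fun v => ((1 + v ^+ 2)^-1)%:E).
Proof.
have sub : (`]0, +oo[%classic : set R) `<=` `[0, +oo[%classic.
  by apply: subset_itvr; rewrite bnd_simp.
apply: (@integrableS _ _ R mu _ _ _ (measurable_itv _) (measurable_itv _) sub).
apply/integrableP; split.
  apply/measurable_EFinP; apply: (@measurable_funS _ _ _ _ setT) => //.
  by apply: continuous_measurable_fun; exact: continuous_oneDsqrV.
under eq_integral => v _ do rewrite gee0_abs ?lee_fin ?invr_ge0 ?addr_ge0 ?sqr_ge0//.
by have := @integral0y_oneDsqr R; rewrite /oneDsqr => ->; exact: ltry.
Qed.

Variables (f : nat -> R -> R) (t : R).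
Hypotheses (cf : chain f) (t0 : 0 < t).
Hypothesis f_ge0 : forall i s, 0 < s -> 0 <= f i s.
Hypothesis f_lower : forall i s, 0 < s -> rate t s / 2 * f i s <= f i.+1 s.

Lemma chain_continuous i s : 0 < s -> {for s, continuous (f i)}.
Proof. by move=> s0; exact: is_derive_continuous (cf i s0). Qed.

(** Gaussian decay beats the exponential growth of [cosh]. The constant comes from
s - s^2 / 4t <= t. *)
Lemma chain_le_coshV i (p s : R) : 0 < p -> p <= s ->
  f i s <= f i p * expR (p ^+ 2 / (4 * t) + t) / cosh s.
Proof.
move=> p0 ps; have c0 := cosh_gt0 s.
rewrite ler_pdivlMr//.
have fp := f_ge0 i p0.
have cs : cosh s <= expR s.
  rewrite -cosh_sinh_expR lerDl; apply: (le_trans _ (ler_sinh _)); lra.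
apply: le_trans (ler_pM _ _ (chain_decay cf t0 (f_lower i) p0 ps) cs) _.
- by rewrite f_ge0// (lt_le_trans p0).
- exact: ltW.
rewrite -mulrA ler_wpM2l// -expRD ler_expR.
rewrite -subr_ge0 (_ : _ - _ = (s - 2 * t) ^+ 2 / (4 * t)).
  by rewrite divr_ge0 ?sqr_ge0// mulr_ge0// ltW.
by field; rewrite gt_eqF.
Qed.

Lemma shell_le_oneDsqrV i (p r v : R) : 0 < p -> p <= r -> 0 <= v ->
  f i (shell r v) <= f i p * expR (p ^+ 2 / (4 * t) + t) * (1 + v ^+ 2)^-1.
Proof.
move=> p0 pr v0; have r0 := lt_le_trans p0 pr.
apply: le_trans (chain_le_coshV i p0 (le_trans pr (shell_ge r0 v0))) _.
rewrite ler_wpM2l ?mulr_ge0 ?f_ge0 ?expR_ge0// cosh_shell//.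
have := cosh_ge1 r; have := sqr_ge0 v => v2 c1.
by rewrite lef_pV2 ?posrE; lra.
Qed.

Lemma integrable_shell i r : 0 < r ->
  mu.-integrable (`]0, +oo[%classic : set R) (fun v => (2 * f i (shell r v))%:E).
Proof.
move=> r0; set M := f i r * expR (r ^+ 2 / (4 * t) + t).
have M0 : 0 <= M by rewrite mulr_ge0 ?f_ge0 ?expR_ge0.
apply: (@le_integrable _ _ R mu _ (measurable_itv _) _
  (fun v : R => ((2 * M)%:E * ((1 + v ^+ 2)^-1)%:E)%E)).
- apply/measurable_EFinP; apply: open_continuous_measurable_fun; first exact: interval_open.
  move=> v _; apply: (@cvgM _ _ _ _ (cst 2)); first exact: cvg_cst.
  apply: continuous_comp; first exact: continuous_shell.
  by apply: chain_continuous; exact: shell_gt0.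
- move=> v /=; rewrite in_itv/= andbT => v0.
  rewrite lee_fin !ger0_norm ?mulr_ge0 ?invr_ge0 ?addr_ge0 ?sqr_ge0 ?f_ge0 ?shell_gt0//.
  by rewrite -mulrA ler_wpM2l// shell_le_oneDsqrV// ltW.
- apply: integrableZl; [exact: measurable_itv|exact: integrable_oneDsqrV].
Qed.

Lemma abel_shell i r : 0 < r ->
  abel (f i) r = \int[mu]_(v in `]0, +oo[) (2 * f i (shell r v)).
Proof.
move=> r0; rewrite /abel /Rintegral abel_substitution// => s s0.
- exact: chain_continuous.
- exact: f_ge0.
Qed.

Lemma abel_ge0 i r : 0 < r -> 0 <= abel (f i) r.
Proof.
move=> r0; rewrite abel_shell// Rintegral_ge0// => v _.
by rewrite mulr_ge0// f_ge0// shell_gt0.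
Qed.

(** After the substitution r enters through cosh r only, and F is a function of
cosh s; so - (sinh r)^-1 d/dr passes to F. *)
Lemma is_derive_shell_radius i r v : 0 < r ->
  is_derive r 1 (fun x => 2 * f i (shell x v)) (- sinh r * (2 * f i.+1 (shell r v))).
Proof.
move=> r0; have h := shell_arg_gt1 v r0.
have d0 : is_derive r 1 (fun x : R => cosh x + v ^+ 2) (sinh r).
  by apply: is_derive_eq; rewrite addr0.
have d1 := is_derive1_comp (g := fun x : R => cosh x + v ^+ 2)
  (is_derive_chain_acosh i cf h) d0.
apply: (is_derive_eq (is_deriveM (is_derive_cst (2 : R) r 1) d1)).
rewrite /GRing.scale /= /shell; ring.
Qed.

Lemma is_derive_abel i r : 0 < r ->
  is_derive r 1 (abel (f i)) (- (sinh r * abel (f i.+1) r)).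
Proof.
move=> r0; pose p := r / 2; pose q := r + 1.
have p0 : 0 < p by rewrite divr_gt0.
have Ip : r \in `]p, q[ by rewrite in_itv/= /p /q; apply/andP; split; lra.
pose M := f i.+1 p * expR (p ^+ 2 / (4 * t) + t).
have M0 : 0 <= M by rewrite mulr_ge0 ?f_ge0 ?expR_ge0.
pose G (v : R) := 2 * sinh q * M * (1 + v ^+ 2)^-1.
have q0 : 0 < sinh q by rewrite sinh_gt0// addr_gt0.
have G0 v : 0 <= G v.
  apply: mulr_ge0; last by rewrite invr_ge0 addr_ge0// sqr_ge0.
  by apply: mulr_ge0 => //; apply: mulr_ge0 => //; exact: ltW.
have mI : measurable (`]0, +oo[%classic : set R) by exact: measurable_itv.
have pos x : `]p, q[%classic x -> 0 < x.
  by rewrite /= in_itv/= => /andP[px _]; exact: lt_trans px.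
have iF x : `]p, q[%classic x ->
    mu.-integrable (`]0, +oo[%classic : set R) (EFin \o (fun v => 2 * f i (shell x v))).
  by move=> /pos x0; exact: integrable_shell.
have dF x v : `]p, q[%classic x -> (`]0, +oo[%classic : set R) v ->
    derivable (fun x => 2 * f i (shell x v)) x 1.
  by move=> /pos x0 _; exact: (@ex_derive _ _ _ _ _ _ _ (is_derive_shell_radius i v x0)).
have iG : mu.-integrable (`]0, +oo[%classic : set R) (EFin \o G).
  rewrite (_ : _ \o _ = (fun v => ((2 * sinh q * M)%:E * ((1 + v ^+ 2)^-1)%:E)%E)).
    by apply: integrableZl => //; exact: integrable_oneDsqrV.
  by apply/funext => v /=; rewrite -EFinM.
have bG x v : `]p, q[%classic x -> (`]0, +oo[%classic : set R) v ->
    `|partial1of2 (fun x v => 2 * f i (shell x v)) x v| <= G v.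
  move=> Ix /=; rewrite in_itv/= andbT => v0; have x0 := pos _ Ix.
  have [px xq] : p < x /\ x < q by move: Ix; rewrite /= in_itv/= => /andP[].
  rewrite /partial1of2 (derive1_is_derive (is_derive_shell_radius i v x0)).
  have s0 := sinh_gt0 x0.
  have sq : sinh x <= sinh q by exact/sinh_le/ltW.
  have fx := f_ge0 i.+1 (shell_gt0 v x0).
  rewrite normrM normrN !ger0_norm ?(mulr_ge0 _ fx) ?(ltW s0)//.
  have := ler_pM (ltW s0) fx sq (shell_le_oneDsqrV i.+1 p0 (ltW px) (ltW v0)).
  by rewrite -/M /G; lra.
have Ia : `]p, q[%classic r by [].
have dI := @derivable_under_integral _ _ _ mu _ _ mI _ _ _ Ia iF dF _ G0 iG bG.
have eI := @differentiation_under_integral _ _ _ mu _ _ mI _ _ _ Ia iF dF _ G0 iG bG.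
apply: (is_derive_eq_gt0 r0 (fun x => @abel_shell i x)).
apply: DeriveDef; first exact: dI.
rewrite -derive1E eI abel_shell// -mulNr -RintegralZl//; last exact: integrable_shell.
apply: eq_Rintegral => v _.
by rewrite /partial1of2 (derive1_is_derive (is_derive_shell_radius i v r0)).
Qed.

End abel_chain.

(** * Concentration of the half-integral near s = r *)

Section concentration.
Context {R : realType}.
Local Notation mu := (@lebesgue_measure R).

Lemma continuous_sqrV (v : R) : v != 0 ->
  {for v, continuous (fun x : R => (x ^+ 2)^-1)}.
Proof.
move=> v0; have h1 : is_derive v 1 (fun x : R => x ^+ 2) (2 * v).
  by apply: is_derive_eq; rewrite /GRing.scale /=; ring.
by have := is_derive_continuous (@is_deriveV _ (fun x : R => x ^+ 2) _ _ _ (expf_neq0 2 v0) h1).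
Qed.

Lemma integral_sqrV (c : R) : 0 < c ->
  (\int[mu]_(v in `[c, +oo[) ((v ^+ 2)^-1)%:E = (c^-1)%:E)%E.
Proof.
move=> c0.
have nz (v : R) : c <= v -> v != 0 by move=> cv; rewrite gt_eqF// (lt_le_trans c0).
have d (v : R) : c <= v -> is_derive v 1 (fun x : R => - x^-1) ((v ^+ 2)^-1).
  move=> /nz v0; have h := is_deriveV v0 (is_derive_id v (1 : R)).
  apply: (is_derive_eq (is_deriveN h)).
  by rewrite scaleNr opprK /GRing.scale /= mulr1.
have d2 (v : R) : c <= v -> {for v, continuous (fun x : R => (x ^+ 2)^-1)}.
  by move=> /nz; exact: continuous_sqrV.
rewrite (@ge0_continuous_FTC2y _ _ (fun x => - x^-1) c 0).
- by rewrite sub0e EFinN oppeK.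
- by move=> v _; rewrite invr_ge0 sqr_ge0.
- apply/continuous_within_itvcyP; split.
    by move=> v; rewrite in_itv/= andbT => cv; apply: d2; exact: ltW.
  by apply: cvg_at_right_filter; exact: d2.
- have h : \forall v \near +oo%R, 0 < (v : R) by exact: nbhs_pinfty_gt.
  have hV : (fun v : R => v^-1) v @[v --> +oo%R] --> 0.
    exact: ((gtr0_cvgV0 h).2 cvg_id).
  by rewrite -oppr0; exact: cvgN.
- by move=> v /ltW /d h; exact: (@ex_derive _ _ _ _ _ _ _ h).
- by apply: cvg_at_right_filter; exact: is_derive_continuous (d c (lexx c)).
- by move=> v; rewrite in_itv/= andbT => /ltW /d; exact: derive1_is_derive.
Qed.

Lemma integrable_mull (D : set R) (k : R) (g : R -> R) : measurable D ->
  mu.-integrable D (EFin \o g) -> mu.-integrable D (EFin \o (fun v => k * g v)).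
Proof.
move=> mD ig; rewrite (_ : _ \o _ = (fun v => k%:E * (EFin \o g) v)%E).
  exact: integrableZl.
by apply/funext => v; rewrite /= EFinM.
Qed.

Lemma head_controls_total (total head tail K m : R) : 0 <= K -> m <= head ->
  tail <= K * m -> total - head = tail -> total <= (1 + K) * head.
Proof. by move=> K0 h1 h2 e; have := ler_wpM2l K0 h1; lra. Qed.

(** The integral of c^2 / v^2 over v > c is c, so the tail is at most K times the
rectangle of height [m] that lies below [g] on ]0, c]. *)
Lemma integral_concentration (g : R -> R) (c m K : R) : 0 < c -> 0 <= m -> 0 <= K ->
  mu.-integrable (`]0, +oo[%classic : set R) (EFin \o g) ->
  (forall v, 0 < v -> v <= c -> m <= g v) ->
  (forall v, c < v -> g v <= K * m * c ^+ 2 * (v ^+ 2)^-1) ->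
  \int[mu]_(v in `]0, +oo[) g v <= (1 + K) * \int[mu]_(v in `]0, c]) g v.
Proof.
move=> c0 m0 K0 ig lo up.
have e := @Rintegral_itvB R g (BRight 0) (BInfty R false) c ig.
have {}e : \int[mu]_(v in `]0, +oo[) g v - \int[mu]_(v in `]0, c]) g v =
    \int[mu]_(v in `]c, +oo[) g v by apply: e; rewrite bnd_simp// ltW.
have sub1 : (`]0, c]%classic : set R) `<=` `]0, +oo[%classic.
  by apply: subset_itvl; rewrite bnd_simp.
have sub2 : (`]c, +oo[%classic : set R) `<=` `]0, +oo[%classic.
  by apply: subset_itvr; rewrite bnd_simp ltW.
have ig1 := @integrableS _ _ R mu _ _ _ (measurable_itv _) (measurable_itv _) sub1 ig.
have ig2 := @integrableS _ _ R mu _ _ _ (measurable_itv _) (measurable_itv _) sub2 ig.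
have mV : measurable_fun (`]c, +oo[%classic : set R) (fun v : R => (v ^+ 2)^-1).
  apply: open_continuous_measurable_fun; first exact: interval_open.
  move=> v; rewrite inE/= in_itv/= andbT => cv; apply: continuous_sqrV.
  by rewrite gt_eqF// (lt_trans c0).
have iV2 : mu.-integrable (`]c, +oo[%classic : set R) (EFin \o (fun v : R => (v ^+ 2)^-1)).
  apply/integrableP; split; first exact/measurable_EFinP.
  under eq_integral => v _ do rewrite gee0_abs ?lee_fin ?invr_ge0 ?sqr_ge0//.
  rewrite integral_itv_obnd_cbnd ?integral_sqrV ?ltry//.
  exact/measurable_EFinP.
have h1 : m * c <= \int[mu]_(v in `]0, c]) g v.
  have -> : m * c = \int[mu]_(v in `]0, c]) (cst m v).
    by rewrite Rintegral_cst//= lebesgue_measure_itv/= lte_fin c0 /= oppr0 addr0.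
  apply: le_Rintegral => //.
    apply/integrableP; split; first exact/measurable_EFinP/measurable_cst.
    rewrite (eq_integral (cst `|m%:E|%E)) ?integral_cst//= lebesgue_measure_itv/= lte_fin c0.
    by rewrite -EFinB -EFinM ltry.
  by move=> v /=; rewrite in_itv/= => /andP[v0 vc]; exact: lo.
have h2 : \int[mu]_(v in `]c, +oo[) g v <= K * (m * c).
  have -> : K * (m * c) = K * m * c ^+ 2 * c^-1 by field; rewrite gt_eqF.
  have -> : c^-1 = \int[mu]_(v in `]c, +oo[) (v ^+ 2)^-1.
    by rewrite Rintegral_itv_obnd_cbnd// /Rintegral integral_sqrV.
  rewrite -RintegralZl//.
  apply: le_Rintegral => //.
    exact: (integrable_mull _ (measurable_itv _) iV2).
  by move=> v /=; rewrite in_itv/= andbT; exact: up.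
exact: head_controls_total K0 h1 h2 e.
Qed.

Lemma integral_head_le (g : R -> R) (c : R) : 0 < c ->
  mu.-integrable (`]0, +oo[%classic : set R) (EFin \o g) ->
  (forall v, 0 < v -> 0 <= g v) ->
  \int[mu]_(v in `]0, c]) g v <= \int[mu]_(v in `]0, +oo[) g v.
Proof.
move=> c0 ig g0; rewrite -subr_ge0.
have e := @Rintegral_itvB R g (BRight 0) (BInfty R false) c ig.
rewrite e ?bnd_simp//; last exact: ltW.
apply: Rintegral_ge0 => v /=; rewrite in_itv/= andbT => cv.
by apply: g0; exact: lt_trans cv.
Qed.

End concentration.

Section abel_ratio.
Context {R : realType}.
Implicit Types (s r v : R).
Local Notation mu := (@lebesgue_measure R).

Lemma rate_anti (t r s : R) : 0 < t -> 0 < r -> r <= s -> rate t s <= rate t r.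
Proof.
move=> t0 r0 rs; have s0 := lt_le_trans r0 rs.
have sr := sinh_gt0 r0; have ss := sinh_gt0 s0.
have h : 0 <= r * sinh (r + (s - r)) - (r + (s - r)) * sinh r.
  have d0 : 0 <= s - r by rewrite subr_ge0.
  apply: (@ge0_of_derive _ (fun x => r * sinh (r + x) - (r + x) * sinh r)
    (fun x => r * cosh (r + x) - sinh r)) d0.
  - move=> x.
    have d1 : is_derive x 1 (fun x : R => r + x) 1 
      by apply: (is_derive_eq (is_deriveD (is_derive_cst r x 1) (is_derive_id x 1))); rewrite add0r.
    have d2 := is_derive1_comp (g := fun x : R => r + x) (is_derive_sinh (r + x)) d1.
    have d3 : is_derive x 1 (fun x => r * sinh (r + x)) (r * cosh (r + x)).
      apply: (is_derive_eq (is_deriveM (is_derive_cst r x 1) d2)).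
      by rewrite /GRing.scale /= ; ring.
    have d4 : is_derive x 1 (fun x : R => (r + x) * sinh r) (sinh r).
      apply: (is_derive_eq (is_deriveM d1 (is_derive_cst (sinh r) x 1))).
      by rewrite /GRing.scale /= ; ring.
    exact: (is_deriveB d3 d4).
  - move=> x x0; rewrite subr_ge0.
    have : r * cosh r <= r * cosh (r + x).
      by rewrite ler_wpM2l ?(ltW r0)// ler_cosh ?(ltW r0)// lerDl ltW.
    by apply: le_trans; have := sinhquo_num_ge0 1 (ltW r0); rewrite /= subr_ge0.
  - by rewrite addr0 subrr.
rewrite /rate -subr_ge0.
have -> : r / (t * sinh r) - s / (t * sinh s) =
    (r * sinh s - s * sinh r) / (t * sinh r * sinh s).
  by field; rewrite !gt_eqF.
rewrite [r + _]addrC subrK in h.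
apply: divr_ge0 => //.
by apply: mulr_ge0; [apply: mulr_ge0|]; exact: ltW.
Qed.

(** The ratio of the rates at r and r + 1 is bounded both as r tends to 0 and as r
tends to infinity, since r cosh r <= (r + 1) sinh r. *)
Lemma rate_succ (t r : R) : 0 < t -> 0 < r -> rate t r <= expR 1 * rate t (r + 1).
Proof.
move=> t0 r0; have r1 : 0 < r + 1 by exact: addr_gt0.
have sr := sinh_gt0 r0; have s1 := sinh_gt0 r1.
have h : r * sinh (r + 1) <= expR 1 * ((r + 1) * sinh r).
  have rc : r * cosh r <= (r + 1) * sinh r.
    have : r * (cosh r - sinh r) <= sinh r.
      apply: le_trans (ler_sinh (ltW r0)); rewrite ler_piMr ?(ltW r0)//.
      have -> : cosh r - sinh r = expR (- r) by exact: coshB_sinh_expR.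
      by rewrite -expR0 ler_expR; lra.
    lra.
  have s10 : 0 < sinh (1 : R) by exact: sinh_gt0.
  rewrite sinhD -cosh_sinh_expR.
  have := ler_wpM2l (ltW s10) rc.
  have : 0 <= cosh 1 * sinh r by apply: mulr_ge0; apply: ltW => //; exact: cosh_gt0.
  lra.
rewrite /rate -subr_ge0.
have -> : expR 1 * ((r + 1) / (t * sinh (r + 1))) - r / (t * sinh r) =
    (expR 1 * ((r + 1) * sinh r) - r * sinh (r + 1)) / (t * sinh r * sinh (r + 1)).
  by field; rewrite !gt_eqF.
apply: divr_ge0; first by rewrite subr_ge0.
by apply: mulr_ge0; [apply: mulr_ge0|]; exact: ltW.
Qed.

(** Bounds exp (r + 1) by a multiple of cosh (r + 1) - cosh r, uniformly in r. *)
Definition tail_cst : R := expR 1 / (cosh 1 - 1).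

Lemma tail_cst_gt0 : 0 < tail_cst.
Proof. by rewrite /tail_cst divr_gt0 ?expR_gt0// subr_gt0 cosh_gt1. Qed.

Lemma expR_le_cosh_gap r : 0 < r -> expR (r + 1) <= tail_cst * (cosh (r + 1) - cosh r).
Proof.
move=> r0; have c1 : 0 < cosh 1 - (1 : R) by rewrite subr_gt0 cosh_gt1.
have hgap : (cosh 1 - 1) * expR r <= cosh (r + 1) - cosh r.
  have := sinh_gt0 r0; have : cosh 1 - 1 <= sinh (1 : R).
    have : cosh (1 : R) - sinh 1 = expR (- 1) by exact: coshB_sinh_expR.
    have : expR (- 1 : R) <= 1 by rewrite -[leRHS]expR0 ler_expR; lra.
    lra.
  rewrite coshD -(cosh_sinh_expR r) => h s0.
  have := ler_wpM2l (ltW s0) h; lra.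
rewrite /tail_cst mulrAC ler_pdivlMr// expRD.
have := ler_wpM2l (expR_ge0 1) hgap; lra.
Qed.

Variables (f : nat -> R -> R) (t : R).
Hypotheses (cf : chain f) (t0 : 0 < t).
Hypothesis f_ge0 : forall i s, 0 < s -> 0 <= f i s.
Hypothesis f_lower : forall i s, 0 < s -> rate t s / 2 * f i s <= f i.+1 s.

Lemma chain_anti i (p s : R) : 0 < p -> p <= s -> f i s <= f i p.
Proof.
move=> p0 ps; apply: le_trans (chain_decay cf t0 (f_lower i) p0 ps) _.
rewrite ler_piMr ?f_ge0// -expR0 ler_expR oppr_le0 divr_ge0 ?mulr_ge0 ?(ltW t0)//.
by rewrite subr_ge0 lerXn2r// nnegrE ltW// (lt_le_trans p0).
Qed.

Lemma abel_upper i r (A : R) : 0 <= A -> 0 < r -> 1 <= (1 + r) / t ->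
  (forall s, 0 < s -> 1 <= (1 + s) / t -> f i.+1 s <= A * rate t s * f i s) ->
  abel (f i.+1) r <= A * rate t r * abel (f i) r.
Proof.
move=> A0 r0 rt up.
rewrite !(abel_shell cf f_ge0)// -RintegralZl//; last exact: (integrable_shell cf t0).
apply: le_Rintegral => //; first exact: (integrable_shell cf t0).
  exact: (integrable_mull _ (measurable_itv _) (integrable_shell cf t0 f_ge0 f_lower i r0)).
move=> v /=; rewrite in_itv/= andbT => v0.
have rs := shell_gt r0 v0; have s0 := shell_gt0 v r0.
rewrite mulrCA ler_wpM2l//.
apply: le_trans (up _ s0 _) _.
  by apply: le_trans rt _; rewrite ler_wpM2r ?invr_ge0 ?(ltW t0)// lerD2l ltW.
by rewrite ler_wpM2r ?f_ge0// ler_wpM2l// rate_anti// ltW.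
Qed.

Lemma chain_lower_near i r s : 0 < r -> 0 < s -> s <= r + 1 ->
  rate t r * f i s <= 2 * expR 1 * f i.+1 s.
Proof.
move=> r0 s0 s1; have h1 := f_lower i s0.
have h2 : rate t r <= expR 1 * rate t s.
  by apply: le_trans (rate_succ t0 r0) _; rewrite ler_wpM2l ?expR_ge0// rate_anti.
have := ler_wpM2l (expR_ge0 1) h1.
have := ler_wpM2r (f_ge0 i s0) h2.
lra.
Qed.

(** The value of v at which s = r + 1. *)
Definition unit_shell r : R := Num.sqrt (cosh (r + 1) - cosh r).

Lemma unit_shell_gt0 r : 0 < r -> 0 < unit_shell r.
Proof.
by move=> r0; rewrite sqrtr_gt0 subr_gt0 ltr_cosh ?(ltW r0)// ltrDl.
Qed.

Lemma sqr_unit_shell r : 0 < r -> unit_shell r ^+ 2 = cosh (r + 1) - cosh r.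
Proof.
by move=> r0; rewrite sqr_sqrtr// ltW// subr_gt0 ltr_cosh ?(ltW r0)// ltrDl.
Qed.

Lemma shell_unit_shell r : 0 < r -> shell r (unit_shell r) = r + 1.
Proof.
by move=> r0; rewrite /shell sqr_unit_shell// addrC subrK acosh_cosh// ltW// addr_gt0.
Qed.

(** Since (1 + r) / t >= 2, beyond s = r + 1 the function decays at least like
exp (r + 1 - s), and exp (- s) <= 1 / cosh s <= v^-2. *)
Lemma abel_concentration i r : 0 < r -> 2 <= (1 + r) / t ->
  \int[mu]_(v in `]0, +oo[) (2 * f i (shell r v)) <=
  (1 + tail_cst) * \int[mu]_(v in `]0, unit_shell r]) (2 * f i (shell r v)).
Proof.
move=> r0 rt; have r1 : 0 < r + 1 by exact: addr_gt0.
have fr1 := f_ge0 i r1.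
have sc := shell_unit_shell r0; have c2 := sqr_unit_shell r0.
have := unit_shell_gt0 r0; set c := unit_shell r in sc c2 * => c0.
apply: (@integral_concentration _ _ c (2 * f i (r + 1))) => //.
- by rewrite mulr_ge0.
- exact: ltW tail_cst_gt0.
- exact: (integrable_shell cf t0).
- move=> v v0 vc; rewrite ler_wpM2l//; apply: chain_anti; first exact: shell_gt0.
  by rewrite -sc shell_le// ltW.
- move=> v cv; have v0 := lt_trans c0 cv.
  have ps : r + 1 <= shell r v by rewrite -sc shell_le// ltW.
  have := chain_decay cf t0 (f_lower i) r1 ps.
  set s := shell r v in ps *.
  have es : expR (- ((s ^+ 2 - (r + 1) ^+ 2) / (4 * t))) <= expR (r + 1) * (v ^+ 2)^-1.
    have h1 : s - (r + 1) <= (s ^+ 2 - (r + 1) ^+ 2) / (4 * t).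
      rewrite ler_pdivlMr ?mulr_gt0//.
      move: rt; rewrite ler_pdivlMr// => rt.
      have d0 : 0 <= s - (r + 1) by rewrite subr_ge0.
      have -> : s ^+ 2 - (r + 1) ^+ 2 = (s - (r + 1)) * (s + (r + 1)) by ring.
      by rewrite ler_wpM2l//; lra.
    have h2 : v ^+ 2 <= expR s.
      rewrite -cosh_sinh_expR /s cosh_shell//.
      have := sinh_gt0 (shell_gt0 v r0); have := cosh_gt0 r; lra.
    apply: (@le_trans _ _ (expR (r + 1) * expR (- s))).
      by rewrite -expRD ler_expR; lra.
    by rewrite ler_wpM2l ?expR_ge0// expRN lef_pV2 ?posrE ?expR_gt0 ?exprn_gt0.
  move=> /le_trans; move=> /(_ _ (ler_wpM2l fr1 es)) h.
  have V0 : 0 <= (v ^+ 2)^-1 by rewrite invr_ge0 sqr_ge0.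
  have := ler_wpM2r (mulr_ge0 fr1 V0) (expR_le_cosh_gap r0).
  rewrite -c2; lra.
Qed.

Lemma abel_lower i r : 0 < r -> 2 <= (1 + r) / t ->
  (2 * expR 1 * (1 + tail_cst))^-1 * rate t r * abel (f i) r <= abel (f i.+1) r.
Proof.
move=> r0 rt; have c0 := unit_shell_gt0 r0; have K0 := tail_cst_gt0.
have k0 : 0 < 2 * expR 1 * (1 + tail_cst).
  by rewrite !mulr_gt0 ?expR_gt0// addr_gt0.
have K1 : 0 <= 1 + tail_cst by rewrite addr_ge0// ltW.
have q0 : 0 <= rate t r.
  by apply: divr_ge0; [exact: ltW|apply: mulr_ge0; apply: ltW => //; exact: sinh_gt0].
have int j := integrable_shell cf t0 f_ge0 f_lower j r0.
have sub1 : (`]0, unit_shell r]%classic : set R) `<=` `]0, +oo[%classic.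
  by apply: subset_itvl; rewrite bnd_simp.
have int1 j := @integrableS _ _ R mu _ _ _ (measurable_itv _) (measurable_itv _) sub1 (int j).
rewrite -mulrA ler_pdivrMl// !(abel_shell cf f_ge0)//.
apply: le_trans (ler_wpM2l q0 (abel_concentration i r0 rt)) _.
rewrite mulrCA [_ * (1 + _)]mulrC -[leRHS]mulrA ler_wpM2l//.
have head_le : \int[mu]_(v in `]0, unit_shell r]) (2 * f i.+1 (shell r v)) <=
    \int[mu]_(v in `]0, +oo[) (2 * f i.+1 (shell r v)).
  apply: (integral_head_le c0 (int i.+1)) => v v0.
  by rewrite mulr_ge0// f_ge0// shell_gt0.
have e0 : 0 <= 2 * expR 1 :> R by rewrite mulr_ge0// expR_ge0.
apply: le_trans (ler_wpM2l e0 head_le).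
rewrite -!RintegralZl//; [|exact: int1..].
apply: le_Rintegral => //.
- exact: (integrable_mull _ (measurable_itv _) (int1 i)).
- exact: (integrable_mull _ (measurable_itv _) (int1 i.+1)).
move=> v /=; rewrite in_itv/= => /andP[v0 vc].
rewrite mulrCA [leRHS]mulrCA ler_wpM2l//.
apply: chain_lower_near => //; first exact: shell_gt0.
by rewrite -(shell_unit_shell r0) shell_le// ltW.
Qed.

End abel_ratio.

(** * The heat kernel *)

Section heat_chains.
Context {R : realType}.

Lemma chain_scale (c : R) (f : nat -> R -> R) :
  chain f -> chain (fun i s => c * f i s).
Proof.
move=> cf i s s0.
apply: (is_derive_eq (is_deriveM (is_derive_cst c s 1) (cf i s s0))).
by rewrite /GRing.scale /=; ring.
Qed.

Lemma chain_heat_fam m p (t : R) : 0 < t -> chain (fun i => heat_fam m (i + p) t).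
Proof.
by move=> t0 i s s0; have [A _ /(_ t s t0 s0)[]] := heat_fam_ratio (R := R) m (i + p).
Qed.

Lemma heat_fam_ge0 m p (t s : R) : 0 < t -> 0 < s -> 0 <= heat_fam m p t s.
Proof. by move=> t0 s0; have [A _ /(_ t s t0 s0)[]] := heat_fam_ratio (R := R) m p. Qed.

Lemma heat_fam_lower m p (t s : R) : 0 < t -> 0 < s ->
  rate t s / 2 * heat_fam m p t s <= heat_fam m p.+1 t s.
Proof. by move=> t0 s0; have [A _ /(_ t s t0 s0)[]] := heat_fam_ratio (R := R) m p. Qed.

(** The constant of [heat_fam_ratio] depends on the number of derivatives; the
theorem involves finitely many of them. *)
Lemma heat_fam_upper m p k : exists2 A : R, 0 < A &
  forall i, (i < k)%N -> forall t s, 0 < t -> 0 < s -> 1 <= (1 + s) / t ->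
  heat_fam m (i.+1 + p) t s <= A * rate t s * heat_fam m (i + p) t s.
Proof.
elim: k => [|k [A A0 hA]]; first by exists 1.
have [B B0 hB] := heat_fam_ratio (R := R) m (k + p).
exists (A + B) => [|i]; first exact: addr_gt0.
move=> ik t s t0 s0 ts.
have F0 := heat_fam_ge0 m (i + p) t0 s0.
have q0 : 0 <= rate t s.
  by apply: divr_ge0; [exact: ltW|apply: mulr_ge0; apply: ltW => //; exact: sinh_gt0].
have qF := mulr_ge0 q0 F0.
have := mulr_ge0 (ltW A0) qF; have := mulr_ge0 (ltW B0) qF.
move: ik; rewrite ltnS leq_eqVlt => /predU1P[ik|ik].
  by rewrite ik in qF *; have [_ _ _ /(_ ts)] := hB t s t0 s0; rewrite /=; lra.
have := hA i ik t s t0 s0 ts; lra.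
Qed.

End heat_chains.

Theorem proposition2p4 (R : realType) (S : damek_ricci R) (k : nat) (alpha : R)
    (halpha1 : 1 <= alpha) (halpha2 : alpha < 2) :
  exists2 gamma : R, 0 < gamma &
  exists2 c : R, 0 < c &
    forall r t : R, 0 < r -> 0 < t ->
      gamma <= (1 + r) / t ->
      1 < r \/ r `^ alpha * (1 + (1 + r) / t) < 1 ->
      c * (Psi k r t * heat_kernel S t r)
        <= `| derive1n k (heat_kernel S t) r |.
Proof.
pose m := (mu S)./2.
case: (boolP (odd (nu S))) => nuS.
- pose p := (nu S).+1./2.
  have [A A0 hA] := heat_fam_upper (R := R) m p k.
  have a0 : 0 < (2 * expR 1 * (1 + @tail_cst R))^-1.
    by rewrite invr_gt0 !mulr_gt0 ?expR_gt0// addr_gt0// tail_cst_gt0.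
  have [gamma g0 [c c0' hc]] := derive1n_chain_lower k halpha1 halpha2 a0 A0.
  (* the concentration estimate requires (1 + r) / t >= 2 *)
  exists (gamma + 2); first exact: addr_gt0.
  exists c => // r t r0 t0 g cond.
  have gr : gamma <= (1 + r) / t by apply: le_trans g; rewrite lerDl.
  have g2 : 2 <= (1 + r) / t by apply: le_trans g; rewrite lerDr ltW.
  have g1 : 1 <= (1 + r) / t by apply: le_trans g2; rewrite ler1n.
  pose C := c0 S * (Num.sqrt pi)^-1 * (Num.sqrt t)^-1 * expR (- (homdim S ^+ 2 * t / 4)).
  have C0 : 0 <= C.
    by rewrite /C !mulr_ge0 ?invr_ge0 ?sqrtr_ge0 ?expR_ge0// powR_ge0.
  pose F i := heat_fam m (i + p) t.
  have cF : chain F by exact: chain_heat_fam.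
  have F0 i s : 0 < s -> 0 <= F i s by exact: heat_fam_ge0.
  have Fl i s : 0 < s -> rate t s / 2 * F i s <= F i.+1 s by exact: heat_fam_lower.
  pose f i s := C * abel (F i) s.
  have cf : chain f.
    by apply: chain_scale => i s s0; exact: (is_derive_abel cF t0).
  have -> : heat_kernel S t = f 0%N by apply/funext => s; rewrite /heat_kernel nuS.
  apply: hc => //.
  - by move=> i; rewrite mulr_ge0// (abel_ge0 cF).
  - by move=> i; rewrite [leLHS]mulrCA ler_wpM2l// (abel_lower cF t0).
  - move=> i ik; rewrite [leRHS]mulrCA ler_wpM2l//.
    apply: (abel_upper cF t0) => //; first exact: ltW.
    by move=> s s0 gs; exact: hA.
- pose p := (nu S)./2.
  have [A A0 hA] := heat_fam_upper (R := R) m p k.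
  have a0 : 0 < 2^-1 :> R by rewrite invr_gt0.
  have [gamma g0 [c c0' hc]] := derive1n_chain_lower k halpha1 halpha2 a0 A0.
  exists (gamma + 1); first exact: addr_gt0.
  exists c => // r t r0 t0 g cond.
  have gr : gamma <= (1 + r) / t by apply: le_trans g; rewrite lerDl.
  have g1 : 1 <= (1 + r) / t by apply: le_trans g; rewrite lerDr ltW.
  pose C := c0 S * (Num.sqrt t)^-1 * expR (- (homdim S ^+ 2 * t / 4)).
  have C0 : 0 <= C.
    by rewrite /C !mulr_ge0 ?invr_ge0 ?sqrtr_ge0 ?expR_ge0// powR_ge0.
  pose f i s := C * heat_fam m (i + p) t s.
  have cf : chain f by apply: chain_scale; exact: chain_heat_fam.
  have -> : heat_kernel S t = f 0%N.
    by apply/funext => s; rewrite /heat_kernel (negbTE nuS).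
  apply: hc => //.
  - by move=> i; rewrite mulr_ge0// heat_fam_ge0.
  - move=> i; rewrite [leLHS]mulrCA ler_wpM2l// [2^-1 * _]mulrC.
    exact: heat_fam_lower.
  - by move=> i ik; rewrite [leRHS]mulrCA ler_wpM2l// hA.
Qed.
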